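(* Let $\mathcal N$ be an atomic nest on a complex Hilbert space $\mathfrak H$ which is order isomorphic to $\mathbb N$, say $\mathcal N=\{N_k: 0\le k\le\infty\}$ with $\{0\}=N_0\subsetneq N_1\subsetneq N_2\subsetneq\cdots$ and $N_\infty=\overline{\bigcup_{k}N_k}=\mathfrak H$. Suppose its atoms $E_k=P(N_k)-P(N_{k-1})$, $k\ge 1$, are finite dimensional, of rank $n_k$ satisfying $n_k\ge 4\sum_{i<k}n_i$ for all $k$. Then $$\operatorname{ltsr}(\mathcal T(\mathcal N))=\infty\quad\text{and}\quad \operatorname{rtsr}(\mathcal T(\mathcal N))=2.$$
   Context: For a unital Banach algebra $\mathcal A$ and $n\ge1$, $Lg_n(\mathcal A)$ is the set of $(a_1,\dots,a_n)\in\mathcal A^n$ for which there exist $b_1,\dots,b_n\in\mathcal A$ with $\sum_{i=1}^n b_ia_i=1$, and $Rg_n(\mathcal A)$ is the set of $(a_1,\dots,a_n)\in\mathcal A^n$ for which there exist $b_1,\dots,b_n\in\mathcal A$ with $\sum_{i=1}^n a_ib_i=1$. The left topological stable rank $\operatorname{ltsr}(\mathcal A)$ (resp. right topological stable rank $\operatorname{rtsr}(\mathcal A)$) is the least positive integer $n$ for which $Lg_n(\mathcal A)$ (resp. $Rg_n(\mathcal A)$) is norm dense in $\mathcal A^n$, and is $\infty$ if no such $n$ exists. A nest $\mathcal N$ on a Hilbert space $\mathfrak H$ is a chain of closed subspaces of $\mathfrak H$ containing $\{0\}$ and $\mathfrak H$ and closed under arbitrary intersections and closed linear spans. $P(M)$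 denotes the orthogonal projection onto a closed subspace $M$. For $N\in\mathcal N$, $N_+=\inf\{M\in\mathcal N: M>N\}$; if $N_+\ne N$, then $N_+\ominus N$ (or its projection $P(N_+)-P(N)$) is called an atom of $\mathcal N$. The nest is atomic if $\mathfrak H$ is spanned by its atoms. The nest algebra is $\mathcal T(\mathcal N)=\{T\in\mathcal B(\mathfrak H): TN\subseteq N\text{ for all }N\in\mathcal N\}$, with the operator norm. *)

(* Defs.v *)
From HB Require Import structures.
From mathcomp Require Import all_boot all_order all_algebra.
From mathcomp Require Import sesquilinear complex.
From mathcomp Require Import all_classical all_reals all_analysis.

Set Implicit Arguments.
Unset Strict Implicit.
Unset Printing Implicit Defensive.

Import Order.TTheory GRing.Theory Num.Theory.
Import numFieldNormedType.Exports.

Local Open Scope classical_set_scope.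
Local Open Scope ring_scope.
Local Open Scope complex_scope.

(* The ring operations are fields of the mixin because Hierarchy Builder cannot
   join [GRing.PzRing] with [NormedModule] over an arbitrary field.  [ba_one = 0]
   is allowed, for the operators on the zero space. *)
HB.mixin Record CompleteNormedModule_isBanachAlgebra (K : numFieldType) A
    of CompleteNormedModule K A := {
  ba_one : A ;
  ba_mul : A -> A -> A ;
  ba_mulA : associative ba_mul ;
  ba_mul1l : left_id ba_one ba_mul ;
  ba_mul1r : right_id ba_one ba_mul ;
  ba_mulDl : left_distributive ba_mul +%R ;
  ba_mulDr : right_distributive ba_mul +%R ;
  ba_scaleAl : forall (a : K) (x y : A), a *: ba_mul x y = ba_mul (a *: x) y ;
  ba_scaleAr : forall (a : K) (x y : A), a *: ba_mul x y = ba_mul x (a *: y) ;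
  ba_normM : forall x y : A, `|ba_mul x y| <= `|x| * `|y|
}.

#[short(type="banachAlgType")]
HB.structure Definition BanachAlgebra (K : numFieldType) :=
  {A of CompleteNormedModule K A & CompleteNormedModule_isBanachAlgebra K A}.

HB.mixin Record CompleteNormedModule_isHilbert (R : realType) H
    of CompleteNormedModule R[i] H := {
  (* linear in the first argument, conjugate-linear in the second *)
  inner : {dot H for @Num.conj R[i]} ;
  inner_norm : forall x : H, inner x x = `|x| ^+ 2
}.

#[short(type="hilbertType")]
HB.structure Definition Hilbert (R : realType) :=
  {H of CompleteNormedModule R[i] H & CompleteNormedModule_isHilbert R H}.

Section StableRank.
Context {K : numFieldType} (A : banachAlgType K).

(* ['rV[A]_n] carries the product of the norm topologies. *)
Definition Lg (n : nat) : set 'rV[A]_n :=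
  [set a | exists b : 'rV[A]_n, \sum_(i < n) ba_mul (b 0 i) (a 0 i) = ba_one].

Definition Rg (n : nat) : set 'rV[A]_n :=
  [set a | exists b : 'rV[A]_n, \sum_(i < n) ba_mul (a 0 i) (b 0 i) = ba_one].

Definition least_pos (P : nat -> Prop) : \bar nat :=
  if pselect (exists n, `[< (0 < n)%N /\ P n >]) is left exP
  then (ex_minn exP)%:E else +oo%E.

Definition ltsr : \bar nat := least_pos (fun n => dense (@Lg n)).
Definition rtsr : \bar nat := least_pos (fun n => dense (@Rg n)).

End StableRank.

Section Nest.
Context {R : realType} (H : hilbertType R).

Definition subspace_set (M : set H) :=
  M 0 /\ forall (a : R[i]) x y, M x -> M y -> M (a *: x + y).

Definition closed_subspace (M : set H) := subspace_set M /\ closed M.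

Definition closed_span (X : set H) : set H := smallest closed_subspace X.

Record is_nest (NN : set (set H)) : Prop := IsNest {
  nest_closed_subspace : forall M, NN M -> closed_subspace M ;
  nest_chain : forall M M', NN M -> NN M' -> M `<=` M' \/ M' `<=` M ;
  nest0 : NN [set 0] ;
  nestT : NN setT ;
  nest_bigcap : forall S, S `<=` NN -> NN (\bigcap_(M in S) M) ;
  nest_span : forall S, S `<=` NN -> NN (closed_span (\bigcup_(M in S) M))
}.

Record nest := Nest { nest_set :> set (set H) ; nestP : is_nest nest_set }.

(* For a closed subspace [M] such a [y] exists and is unique; [0] is only the
   default value of [xget]. *)
Definition orth_proj (M : set H) (x : H) : H :=
  xget 0 [set y | M y /\ forall z, M z -> inner (x - y) z = 0].

(* The infimum of the empty family is the whole space, so [nest_succ NN setT]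
   is [setT]. *)
Definition nest_succ (NN : nest) (N : set H) : set H :=
  \bigcap_(M in [set M | nest_set NN M /\ N `<` M]) M.

Definition nest_atom (NN : nest) (N : set H) : set H :=
  [set x | nest_succ NN N x /\ forall y, N y -> inner x y = 0].

Definition atomic_nest (NN : nest) :=
  closed_span (\bigcup_(N in [set N | nest_set NN N /\ nest_succ NN N <> N])
                 nest_atom NN N) = setT.

Definition has_dim (M : set H) (n : nat) :=
  exists e : 'I_n -> H,
    (forall c : 'I_n -> R[i],
        \sum_(i < n) c i *: e i = 0 -> forall i, c i = 0) /\
    M = [set \sum_(i < n) c i *: e i | c in [set: 'I_n -> R[i]]].

Definition has_rank (T : H -> H) (n : nat) := has_dim (range T) n.

Definition bounded_operator (f : H -> H) :=
  (forall (a : R[i]) x y, f (a *: x + y) = a *: f x + f y) /\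
  exists c : R[i], forall x, `|f x| <= c * `|x|.

Definition nest_operator (NN : nest) (f : H -> H) :=
  bounded_operator f /\ forall N, nest_set NN N -> f @` N `<=` N.

(* Norms take values in [R[i]], where suprema are not available: the supremum is
   taken over the real parts and embedded back. *)
Definition opnorm (f : H -> H) : R[i] :=
  (sup [set complex.Re `|f x| | x in [set x | `|x| <= 1]])%:C.

End Nest.

Section OpNorm.
Context {R : realType} {H : hilbertType R}.
Implicit Types (f g : H -> H) (x y : H).

Lemma hnorm_Re x : `|x| = (complex.Re `|x|)%:C.
Proof. by rewrite RRe_real ?normr_real. Qed.

Lemma hnorm_Re_ge0 x : 0 <= complex.Re `|x|.
Proof. by rewrite -lecR -hnorm_Re normr_ge0. Qed.

Lemma bounded_operator0 f : bounded_operator f -> f 0 = 0.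
Proof.
move=> [fl _]; have := fl 1 0 0; rewrite !scale1r addr0 => h.
by apply: (addIr (f 0)); rewrite add0r -h.
Qed.

Lemma bounded_operatorZ f (a : R[i]) x : bounded_operator f -> f (a *: x) = a *: f x.
Proof. by move=> bf; rewrite -[a *: x]addr0 bf.1 bounded_operator0// addr0. Qed.

Lemma bounded_operator_rbound f : bounded_operator f ->
  exists2 c : R, 0 <= c & forall x, complex.Re `|f x| <= c * complex.Re `|x|.
Proof.
move=> [_ [c hc]]; have /complex_realP[d dE] := normr_real c.
exists d; first by rewrite -lecR -dE normr_ge0.
move=> x; rewrite -lecR rmorphM /= -!hnorm_Re -dE.
have := hc x; have [x0|x0] := eqVneq `|x| 0.
  by rewrite x0 !mulr0.
move=> h; have xp : 0 < `|x| by rewrite lt_def x0 normr_ge0.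
have c0 : 0 <= c by rewrite -(pmulr_lge0 _ xp); apply: le_trans h; exact: normr_ge0.
by rewrite ger0_norm.
Qed.

Let has_sup_opn f : bounded_operator f ->
  has_sup [set complex.Re `|f x| | x in [set x | `|x| <= 1]].
Proof.
move=> bf; split; first by exists (complex.Re `|f 0|), 0; rewrite //= normr0.
have [c c0 hc] := bounded_operator_rbound bf; exists c => _ [x /= x1 <-].
apply: (le_trans (hc x)); rewrite -[leRHS]mulr1 ler_wpM2l//.
by rewrite -lecR -hnorm_Re.
Qed.

Lemma opnorm_le f (c : R) : (forall x, `|x| <= 1 -> complex.Re `|f x| <= c) ->
  opnorm f <= c%:C.
Proof.
move=> h; rewrite lecR; apply: ge_sup.
  by exists (complex.Re `|f 0|), 0; rewrite //= normr0.
by move=> _ [x /= x1 <-]; exact: h.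
Qed.

Lemma opnorm_ub1 f x : bounded_operator f -> `|x| <= 1 -> `|f x| <= opnorm f.
Proof.
move=> bf x1; rewrite hnorm_Re lecR; apply: ub_le_sup; first by case: (has_sup_opn bf).
by exists x.
Qed.

Lemma opnorm_ge0 f : bounded_operator f -> 0 <= opnorm f.
Proof. by move=> bf; apply: le_trans (@opnorm_ub1 _ 0 bf _); rewrite ?normr0. Qed.

Lemma opnorm_ub f x : bounded_operator f -> `|f x| <= opnorm f * `|x|.
Proof.
move=> bf; have [->|x0] := eqVneq x 0; first by rewrite bounded_operator0// !normr0 mulr0.
rewrite -ler_pdivrMr ?normr_gt0//.
suff : `|f (`|x|^-1 *: x)| <= opnorm f.
  by rewrite bounded_operatorZ// normrZ normfV normr_id mulrC.
by apply: opnorm_ub1 => //; rewrite normrZ normfV normr_id mulVf// normr_eq0.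
Qed.

Lemma opnorm_leP f (c : R[i]) : 0 <= c -> (forall x, `|f x| <= c * `|x|) -> opnorm f <= c.
Proof.
move=> c0 h; rewrite -[c](RRe_real (ger0_real c0)); apply: opnorm_le => x x1.
rewrite -lecR -hnorm_Re (RRe_real (ger0_real c0)); apply: (le_trans (h x)).
by rewrite -[leRHS]mulr1 ler_wpM2l.
Qed.

End OpNorm.

Section NestAlgebra.
Context {R : realType} {H : hilbertType R} (NN : nest H).

Definition nest_pred : {pred H -> H} := [pred f | `[< nest_operator NN f >]].

(* The nest algebra T(NN), with the operator norm and composition as product. *)
Record nestAlg := NestAlg { nest_op :> H -> H ; nest_op_in : nest_op \in nest_pred }.

HB.instance Definition _ := [isSub for nest_op].
HB.instance Definition _ := [Choice of nestAlg by <:].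

Lemma nest_submod_closed : submod_closed nest_pred.
Proof.
split.
  apply/asboolP; split.
    split=> [a x y|]; first by rewrite /= scaler0 addr0.
    by exists 0 => x; rewrite mul0r normr0.
  by move=> N NN_N _ [x Nx <-] /=; have [[]] := nest_closed_subspace (nestP NN) NN_N.
move=> a f g /asboolP[bf fN] /asboolP[bg gN]; apply/asboolP; split.
  split=> [b x y|].
    suff : a *: f (b *: x + y) + g (b *: x + y) =
        b *: (a *: f x + g x) + (a *: f y + g y) by [].
    by rewrite bf.1 bg.1 !scalerDr !scalerA (mulrC b a) addrACA.
  exists (`|a| * opnorm f + opnorm g) => x.
  rewrite mulrDl; apply: (le_trans (ler_normD _ _)); apply: lerD; last exact: opnorm_ub.
  by rewrite [X in X <= _]normrZ -mulrA ler_wpM2l// opnorm_ub.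
move=> N NN_N _ [x Nx <-].
have [[N0 Nl] _] := nest_closed_subspace (nestP NN) NN_N.
by apply: Nl; [apply: (fN _ NN_N)|apply: (gN _ NN_N)]; exists x.
Qed.

HB.instance Definition _ := GRing.isSubmodClosed.Build _ _ nest_pred nest_submod_closed.
HB.instance Definition _ := [SubChoice_isSubLmodule of nestAlg by <:].

Implicit Types f g h : nestAlg.

Lemma nest_opP f : nest_operator NN f.
Proof. exact: (asboolW (nest_op_in f)). Qed.

Lemma nest_op_bounded f : bounded_operator f. Proof. by case: (nest_opP f). Qed.

Lemma nestAlg_eqP f g : (forall x, f x = g x) -> f = g.
Proof. by move=> fg; apply/val_inj/funext. Qed.

Lemma nestAlgDE f g x : (f + g : nestAlg) x = f x + g x. Proof. by []. Qed.
Lemma nestAlgZE (a : R[i]) f x : (a *: f : nestAlg) x = a *: f x. Proof. by []. Qed.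
Lemma nestAlgNE f x : (- f : nestAlg) x = - f x. Proof. by []. Qed.

Let opD f g : opnorm (f + g : nestAlg) <= opnorm f + opnorm g.
Proof.
have [bf bg] := (nest_op_bounded f, nest_op_bounded g).
apply: opnorm_leP => [|x]; first by rewrite addr_ge0// opnorm_ge0.
rewrite nestAlgDE mulrDl (le_trans (ler_normD _ _))// lerD//; exact: opnorm_ub.
Qed.

Let opZ (a : R[i]) f : opnorm (a *: f : nestAlg) = `|a| * opnorm f.
Proof.
have bnd (b : R[i]) (g : nestAlg) : opnorm (b *: g : nestAlg) <= `|b| * opnorm g.
  have bg := nest_op_bounded g; apply: opnorm_leP => [|x].
    by rewrite mulr_ge0// opnorm_ge0.
  by rewrite nestAlgZE normrZ -mulrA ler_wpM2l// opnorm_ub.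
apply/le_anti; rewrite bnd andTb; have [->|a0] := eqVneq a 0.
  by rewrite normr0 mul0r opnorm_ge0//; exact: nest_op_bounded.
have := bnd a^-1 (a *: f); rewrite scalerA mulVf// scale1r normfV.
by rewrite mulrC ler_pdivlMr ?normr_gt0// mulrC.
Qed.

Let op_eq0 f : opnorm f = 0 -> f = 0.
Proof.
move=> f0; apply: nestAlg_eqP => x; apply/eqP; rewrite -normr_le0.
by have := opnorm_ub x (nest_op_bounded f); rewrite f0 mul0r.
Qed.

HB.instance Definition _ :=
  Lmodule_isNormed.Build R[i] nestAlg opD opZ op_eq0.

Lemma nestAlg_normE f : `|f| = opnorm f. Proof. by []. Qed.

Lemma nestAlg_ub f x : `|f x| <= `|f| * `|x|.
Proof. exact/opnorm_ub/nest_op_bounded. Qed.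

Lemma nestAlg_one_subproof : (id : H -> H) \in nest_pred.
Proof.
apply/asboolP; split; last by move=> N _ _ [x Nx <-].
by split=> //; exists 1 => x; rewrite mul1r.
Qed.
Definition nestAlg_one := NestAlg nestAlg_one_subproof.

Lemma nestAlg_mul_subproof f g : (nest_op f \o nest_op g) \in nest_pred.
Proof.
have [[bf fN] [bg gN]] := (nest_opP f, nest_opP g).
apply/asboolP; split.
  split=> [a x y|] /=; first by rewrite bg.1 bf.1.
  exists (opnorm f * opnorm g) => x /=; rewrite (le_trans (opnorm_ub _ bf))//.
  by rewrite -mulrA ler_wpM2l ?opnorm_ge0// opnorm_ub.
move=> N NN_N _ [x Nx <-] /=; apply: (fN _ NN_N); exists (g x) => //.
by apply: (gN _ NN_N); exists x.
Qed.
Definition nestAlg_mul f g := NestAlg (nestAlg_mul_subproof f g).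

Let nestAlg_complete (F : set_system nestAlg) :
  ProperFilter F -> cauchy F -> cvg F.
Proof.
move=> FF Fc.
have Fball (e : R[i]) : 0 < e -> exists f0 : nestAlg, F (ball f0 e).
  by move: e; exact: (proj1 (cauchyP F) Fc).
have ev_cvg x : cvg ((fun f : nestAlg => f x) @ F).
  apply: cauchy_cvg; apply/cauchy_exP => e e0.
  have x1 : 0 < `|x| + 1 by apply: ltr_wpDl; rewrite ?normr_ge0 ?ltr01.
  have [f0 Ff0] := Fball (e / (`|x| + 1)) (divr_gt0 e0 x1).
  exists (f0 x); change (F [set f : nestAlg | ball (f0 x) e (f x)]).
  apply: filterS Ff0 => f.
  rewrite -!ball_normE /= => h.
  apply: (le_lt_trans (nestAlg_ub (f0 - f) x)).
  apply: (@le_lt_trans _ _ (e / (`|x| + 1) * `|x|)).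
    by rewrite ler_wpM2r// ltW.
  by rewrite mulrAC ltr_pdivrMr// ltr_pM2l// ltrDl.
pose g (x : H) : H := lim ((fun f : nestAlg => f x) @ F).
have gE x : (fun f : nestAlg => f x) @ F --> g x by exact: ev_cvg.
have near_g (e : R[i]) : 0 < e ->
    F [set f : nestAlg | forall x, `|f x - g x| <= e * `|x|].
  move=> e0; have e20 : 0 < e / 2 by rewrite divr_gt0.
  have [f0 Ff0] := Fball _ e20; apply: filterS (Ff0) => f f0f x /=.
  apply/ler_addgt0Pr => d d0.
  have /filter_ex[h [f0h hg]] : F (ball f0 (e / 2) `&`
      [set h : nestAlg | ball (g x) d (h x)]).
    by apply: filterI => //; apply: gE; exact: nbhsx_ballx.
  have fh : `|f - h| < e.
    by rewrite [e]splitr; have := ball_splitr f0f f0h; rewrite -ball_normE -splitr.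
  move: hg; rewrite -ball_normE /= => hg.
  rewrite -[f x](subrK (h x)) -addrA (le_trans (ler_normD _ _))// lerD//.
    by apply: (le_trans (nestAlg_ub (f - h) x)); rewrite ler_wpM2r// ltW.
  by rewrite distrC ltW.
have g_in : g \in nest_pred.
  apply/asboolP; split; first split.
  - move=> a x y.
    have hr : (fun f : nestAlg => a *: f x + f y) @ F --> a *: g x + g y.
      by apply: cvgD (gE y); apply: cvgZl_tmp (gE x).
    have hl : (fun f : nestAlg => a *: f x + f y) @ F --> g (a *: x + y).
      rewrite (_ : (fun f : nestAlg => a *: f x + f y) =
          (fun f : nestAlg => f (a *: x + y))); first exact: gE.
      by apply: funext => f; rewrite (nest_op_bounded f).1.
    exact: (cvg_unique (@norm_hausdorff _ H) hl hr).
  - have [f hf] := filter_ex (near_g 1 ltr01).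
    exists (1 + `|f|) => x; rewrite mulrDl -[g x](subrK (f x)).
    by rewrite (le_trans (ler_normD _ _))// lerD ?nestAlg_ub// distrC.
  - move=> N NN_N _ [x Nx <-].
    have [_ Ncl] := nest_closed_subspace (nestP NN) NN_N.
    apply: (closed_cvg (u_ := fun f : nestAlg => f x) N Ncl _ _ (gE x)).
    apply: nearW => f.
    by apply: (proj2 (nest_opP f) _ NN_N); exists x.
apply/cvg_ex; exists (NestAlg g_in : nestAlg); apply/fcvg_ballP => e e0.
have e20 : 0 < e / 2 by rewrite divr_gt0.
apply: filterS (near_g _ e20) => f hf; rewrite -ball_normE /=.
apply: (@le_lt_trans _ _ (e / 2)); last by rewrite gtr_pMr// invf_lt1// ltr1n.
by apply: opnorm_leP => [|x]; [exact: ltW|rewrite distrC; exact: hf].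
Qed.

HB.instance Definition _ := Uniform_isComplete.Build nestAlg nestAlg_complete.

Let mulA : associative nestAlg_mul.
Proof. by move=> f g h; apply: nestAlg_eqP. Qed.
Let mul1l : left_id nestAlg_one nestAlg_mul.
Proof. by move=> f; apply: nestAlg_eqP. Qed.
Let mul1r : right_id nestAlg_one nestAlg_mul.
Proof. by move=> f; apply: nestAlg_eqP. Qed.
Let mulDl : left_distributive nestAlg_mul +%R.
Proof. by move=> f g h; apply: nestAlg_eqP. Qed.
Let mulDr : right_distributive nestAlg_mul +%R.
Proof.
move=> f g h; apply: nestAlg_eqP => x /=.
by have [fl _] := nest_op_bounded f; have := fl 1 (g x) (h x); rewrite !scale1r.
Qed.
Let scaleAl (a : R[i]) f g : a *: nestAlg_mul f g = nestAlg_mul (a *: f) g.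
Proof. exact: nestAlg_eqP. Qed.
Let scaleAr (a : R[i]) f g : a *: nestAlg_mul f g = nestAlg_mul f (a *: g).
Proof.
apply: nestAlg_eqP => x.
exact/esym/(bounded_operatorZ a (g x) (nest_op_bounded f)).
Qed.
Let normM f g : `|nestAlg_mul f g| <= `|f| * `|g|.
Proof.
apply: opnorm_leP => [|x /=]; first by rewrite mulr_ge0.
rewrite (le_trans (nestAlg_ub _ _))// -mulrA ler_wpM2l// nestAlg_ub//.
Qed.

HB.instance Definition _ := CompleteNormedModule_isBanachAlgebra.Build R[i] nestAlg
  mulA mul1l mul1r mulDl mulDr scaleAl scaleAr normM.

End NestAlgebra.

(* Main.v *)
Require Import Defs.
From HB Require Import structures.
From mathcomp Require Import all_boot all_order all_algebra.
From mathcomp Require Import sesquilinear spectral complex ring.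
From mathcomp Require Import all_classical all_reals all_analysis.

Set Implicit Arguments.
Unset Strict Implicit.
Unset Printing Implicit Defensive.

Import Order.TTheory GRing.Theory Num.Theory.
Import numFieldNormedType.Exports.

Local Open Scope classical_set_scope.
Local Open Scope ring_scope.
Local Open Scope sesquilinear_scope.

(** Fix an orthonormal basis [e] of the space, indexed by the natural numbers
    and adapted to the nest: [N k] is the set of vectors whose coordinates of
    index at least [s k = n 1 + ... + n k] vanish ([adapted_basis]).  An
    operator is then given by its coordinate functionals
    ([operator_of_coefs]), and it lies in the nest algebra when its matrix is
    block upper triangular.

    Left stable rank.  For each [m] there are [m] elements [A_i] of the nest
    algebra whose adjoints are isometries with pairwise orthogonal ranges that
    all miss [e 0]: let the adjoint of [A_i] send [e a] to [e (m * a + i + 1)].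
    The column [A : H -> H^m] has a right inverse [V] whose range is orthogonal
    to [e 0].  Suppose that [A'] is close to [A] and [B A' = 1], and let [phi]
    be the functional [w |-> inner (B w) (e 0)] on [H^m].  Since
    [B w = B A V w = V w - B (A' - A) V w], it satisfies
    [phi w = - phi ((A' - A) V w)]; as [(A' - A) V] has norm at most [1/2],
    [phi] vanishes.  But [phi (A' (e 0)) = inner (e 0) (e 0) = 1].  So a
    neighbourhood of [A] misses [Lg m] ([Lg_not_dense]).

    Right stable rank.  Two elements of the nest algebra with [S T = 1] also
    satisfy [T S = 1], because this holds on every finite-dimensional [N k]
    ([nestAlg_inverse_comm]).  Hence [Rg 1] lies in [Lg 1] and is not dense.
    For the density of [Rg 2], let [A_1, A_2] be given, let [E_k] be the atom
    [N (k+1)] minus [N k], of dimension [n (k+1)], and split the restriction of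
    the row [(A_1, A_2)] to [E_k + E_k] into its component in [N k] and its
    component in [E_k].  The former goes from dimension [2 n (k+1)] to
    dimension [s k <= n (k+1)], so its kernel contains a subspace [F] of
    dimension [n (k+1)].  A small perturbation of the component in [E_k] makes
    it an isomorphism from [F] onto [E_k], with an inverse whose norm is bounded
    in terms of the size of the perturbation only ([near_invertible],
    [block_perturbation]).  Perturbations and inverses of the different atoms
    assemble into block diagonal operators ([block_diagonal_operator]): these
    are bounded, because the block norms are, and belong to the nest algebra.
    The perturbed row maps the inverses to the identity, since their values lie
    in the kernel of the component in [N k] ([Rg2_dense]). *)

(** * Complex matrices: small perturbations with a bounded inverse *)

Section Matrices.
Context {C : numClosedFieldType}.

Definition sqnorm m (x : 'rV[C]_m) : C := \sum_i `|x 0 i| ^+ 2.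

Lemma sqnormE m (x : 'rV[C]_m) : sqnorm x = (x *m x^t*) 0 0.
Proof. by rewrite mxE; apply: eq_bigr => i _; rewrite !mxE normCK. Qed.

Lemma sqnorm_ge0 m (x : 'rV[C]_m) : 0 <= sqnorm x.
Proof. by apply: sumr_ge0 => i _; rewrite exprn_ge0. Qed.

Lemma sqnorm0 m : sqnorm (0 : 'rV_m) = 0.
Proof. by rewrite sqnormE mul0mx mxE. Qed.

Lemma sqnorm_coisometry m p (K : 'M[C]_(m, p)) (x : 'rV_m) :
  K \is unitarymx -> sqnorm (x *m K) = sqnorm x.
Proof.
move=> /unitarymxP KK; rewrite !sqnormE trmx_mul map_mxM mulmxA.
by rewrite -(mulmxA x) KK mulmx1.
Qed.

(** The difference of the two sides is the squared norm of the component of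
    [x] orthogonal to the row space of [K]. *)
Lemma sqnorm_isometry_le m p (K : 'M[C]_(m, p)) (x : 'rV_p) :
  K \is unitarymx -> sqnorm (x *m K^t*) <= sqnorm x.
Proof.
move=> KU; have /unitarymxP KK := KU.
rewrite -(sqnorm_coisometry (x *m K^t*) KU) -subr_ge0.
suff -> : sqnorm x - sqnorm (x *m K^t* *m K) = sqnorm (x - x *m K^t* *m K).
  exact: sqnorm_ge0.
set y := x *m K^t* *m K.
have yy : y *m y^t* = x *m y^t*.
  rewrite /y !(trmx_mul, map_mxM) trmxCK !mulmxA.
  by rewrite -(mulmxA (x *m K^t*)) KK mulmx1.
have yx : y *m x^t* = y *m y^t*.
  rewrite -[LHS]trmxCK trmx_mul map_mxM trmxCK -yy.
  by rewrite trmx_mul map_mxM trmxCK.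
rewrite !sqnormE linearB /= map_mxB mulmxBl !mulmxBr yx -yy.
by rewrite subrr subr0 [RHS]mxE [X in _ = _ + X]mxE.
Qed.

Lemma sqnormD_le m (x y : 'rV[C]_m) :
  sqnorm (x + y) <= 2 * (sqnorm x + sqnorm y).
Proof.
rewrite /sqnorm -big_split mulr_sumr; apply: ler_sum => i _; rewrite mxE /=.
apply: (@le_trans _ _ ((`|x 0 i| + `|y 0 i|) ^+ 2)).
  by rewrite lerXn2r ?nnegrE ?addr_ge0 // ler_normD.
rewrite -subr_ge0.
suff -> : 2 * (`|x 0 i| ^+ 2 + `|y 0 i| ^+ 2) - (`|x 0 i| + `|y 0 i|) ^+ 2 =
    (`|x 0 i| - `|y 0 i|) ^+ 2 by rewrite real_exprn_even_ge0 // rpredB // normr_real.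
by rewrite sqrrD sqrrB mulrDl mul1r !mulr2n; ring.
Qed.

Lemma sqnormZ m (a : C) (x : 'rV_m) : sqnorm (a *: x) = `|a| ^+ 2 * sqnorm x.
Proof.
by rewrite /sqnorm mulr_sumr; apply: eq_bigr => i _; rewrite mxE normrM exprMn.
Qed.

Lemma sqnorm_diag_le m (d : 'rV[C]_m) (c : C) (x : 'rV_m) : 0 <= c ->
  (forall i, `|d 0 i| <= c) -> sqnorm (x *m diag_mx d) <= c ^+ 2 * sqnorm x.
Proof.
move=> c0 dc; rewrite /sqnorm mulr_sumr; apply: ler_sum => i _.
rewrite mul_mx_diag mxE normrM exprMn mulrC ler_wpM2r ?exprn_ge0 //.
by rewrite lerXn2r ?nnegrE.
Qed.

(** The characteristic polynomial cannot vanish at all [m + 1] numbers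
    [- e / (i + 1)] with [i <= m]. *)
Lemma unitmx_shift m (T : 'M[C]_m) (e : C) : 0 < e ->
  exists2 t : C, 0 <= t <= e & T + t%:M \in unitmx.
Proof.
move=> e0; pose r i : C := - (e / i.+1%:R).
have r_inj : injective r.
  move=> i j /oppr_inj /(mulfI (lt0r_neq0 e0)) /invr_inj /eqP.
  by rewrite eqr_nat eqSS => /eqP.
have [i ri] : exists i : 'I_m.+1, ~~ root (char_poly T) (r i).
  apply/existsP; rewrite -negb_forall; apply/negP => /forallP rr.
  have : (size [seq r i | i <- iota 0 m.+1] < size (char_poly T))%N.
    apply: max_poly_roots; first by rewrite monic_neq0 ?char_poly_monic.
      apply/allP => _ /mapP[i + ->]; rewrite mem_iota add0n => im.
      exact: (rr (Ordinal im)).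
    by rewrite map_inj_uniq ?iota_uniq.
  by rewrite size_map size_iota size_char_poly ltnn.
exists (- r i).
  rewrite /r opprK divr_ge0 ?ler0n ?(ltW e0) //=.
  by rewrite ler_piMr ?(ltW e0) // invf_le1 ?ler1n ?ltr0n.
rewrite -row_free_unit -kermx_eq0; apply/negP => /negP ker.
move: ri; rewrite -eigenvalue_root_char => /negP; apply.
rewrite /eigenvalue /eigenspace; move: ker; rewrite raddfN /=; exact.
Qed.

(** A polar decomposition.  After a shift by a scalar, [T' = S W] with [S]
    positive definite and [W] unitary; then [T' + e W = (S + e) W], and the
    inverse of [S + e] is bounded by [e^-1] whatever the size of the matrix.
    The spectral theorem for [T' T'^*] provides [S], in the form
    [S = P^* diag(sd) P]. *)
Lemma near_invertible m (T : 'M[C]_m) (e : C) : 0 < e ->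
  exists D G : 'M[C]_m, [/\ G *m (T + D) = 1%:M,
    forall x, sqnorm (x *m D) <= (2 * e) ^+ 2 * sqnorm x &
    forall x, sqnorm (x *m G) <= e ^- 2 * sqnorm x].
Proof.
move=> e0; have [t /andP[t0 te] Tu] := unitmx_shift T e0.
set T' := T + t%:M in Tu.
have nm : T' *m T'^t* \is normalmx.
  by apply/normalmxP; rewrite trmx_mul map_mxM trmxCK.
have /orthomx_spectralP := nm; set P := spectralmx _; set d := spectral_diag _.
have PU : P \is unitarymx := spectral_unitarymx _.
rewrite (invmx_unitary PU) => TT.
have /unitarymxP PP := PU.
have PP' : P^t* *m P = 1%:M by apply: mulmx1C.
set Q := P *m T'.
have QQ : Q *m Q^t* = diag_mx d.
  by rewrite trmx_mul map_mxM mulmxA -(mulmxA P) TT !mulmxA PP mul1mx -mulmxA PP mulmx1.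
have dQ i : d 0 i = sqnorm (row i Q).
  have -> : d 0 i = (diag_mx d) i i by rewrite mxE eqxx mulr1n.
  rewrite -QQ sqnormE !mxE; apply: eq_bigr => j _.
  by rewrite !mxE.
have Qu : Q \in unitmx by rewrite unitmx_mul Tu unitarymx_unit.
have d_gt0 i : 0 < d 0 i.
  rewrite lt_def dQ sqnorm_ge0 andbT -dQ; apply/negP => /eqP d0.
  have : diag_mx d \in unitmx by rewrite -QQ unitmx_mul Qu map_unitmx unitmx_tr.
  rewrite unitmxE det_diag unitfE => /prodf_neq0 /(_ i isT).
  by rewrite d0 eqxx.
pose sd := \row_i sqrtC (d 0 i).
have sd_gt0 i : 0 < sd 0 i by rewrite mxE sqrtC_gt0.
pose V := diag_mx (map_mx GRing.inv sd) *m Q.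
have VU : V \is unitarymx.
  apply/unitarymxP; rewrite trmx_mul map_mxM mulmxA -(mulmxA _ Q) QQ.
  rewrite tr_diag_mx map_diag_mx !mulmx_diag -diag_const_mx; congr diag_mx.
  apply/rowP => i; rewrite !mxE.
  rewrite [X in _ * X](_ : _ = (sqrtC (d 0 i))^-1); last first.
    by apply: CrealP; rewrite realV ger0_real // sqrtC_ge0 ltW.
  have s0 : sqrtC (d 0 i) != 0 by rewrite sqrtC_eq0 gt_eqF.
  by rewrite -{2}(sqrtCK (d 0 i)) expr2 mulrA mulVf // mul1r mulfV.
have QE : Q = diag_mx sd *m V.
  rewrite /V mulmxA mulmx_diag -[LHS]mul1mx -diag_const_mx; congr (diag_mx _ *m _).
  by apply/rowP => i; rewrite !mxE mulfV // sqrtC_eq0 gt_eqF.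
have T'E : T' = P^t* *m Q by rewrite mulmxA PP' mul1mx.
have /unitarymxP VV := VU.
have VV' : V^t* *m V = 1%:M by apply: mulmx1C.
pose W := P^t* *m V.
have WU : W \is unitarymx by rewrite mul_unitarymx // trmxC_unitary.
pose se := sd + const_mx e.
have se_ge i : e <= se 0 i by rewrite [leRHS]mxE [X in _ + X]mxE lerDr ltW.
pose G := V^t* *m diag_mx (map_mx GRing.inv se) *m P.
(* [G] is the inverse of [(S + e) W]. *)
exists (t%:M + e *: W), G; split.
- rewrite addrA -/T' T'E QE /W scalemxAr.
  have -> : P^t* *m (diag_mx sd *m V) + P^t* *m (e *: V) = P^t* *m (diag_mx se *m V).
    by rewrite -mulmxDr -mul_scalar_mx -mulmxDl -diag_const_mx -raddfD.
  rewrite /G mulmxA -(mulmxA _ P) PP mulmx1 mulmxA -(mulmxA (V^t*)).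
  rewrite mulmx_diag (_ : \row_j _ = const_mx 1) ?diag_const_mx ?mulmx1 //.
  have se0 i : se 0 i != 0 by rewrite gt_eqF // (lt_le_trans e0 (se_ge i)).
  by apply/rowP => i; rewrite mxE [X in X * _]mxE mulVf // mxE.
- move=> x; rewrite mulmxDr (le_trans (sqnormD_le _ _)) // mul_mx_scalar -scalemxAr.
  rewrite !sqnormZ sqnorm_coisometry // -mulrDl mulrA ler_wpM2r ?sqnorm_ge0 //.
  rewrite (_ : (2 * e) ^+ 2 = 2 * (e ^+ 2 + e ^+ 2)); last by ring.
  rewrite ler_pM2l // lerD //; rewrite ger0_norm ?(ltW e0) //.
  by rewrite lerXn2r ?nnegrE ?(ltW e0).
- move=> x; rewrite /G !mulmxA sqnorm_coisometry // -exprVn.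
  apply: (@le_trans _ _ (e^-1 ^+ 2 * sqnorm (x *m V^t*))).
    apply: sqnorm_diag_le; first by rewrite invr_ge0 ltW.
    move=> i; have sp := lt_le_trans e0 (se_ge i).
    by rewrite mxE normfV gtr0_norm // lef_pV2 ?posrE.
  by rewrite ler_wpM2l ?exprn_ge0 ?invr_ge0 ?(ltW e0) // sqnorm_isometry_le.
Qed.

(** The left kernel of [Y] has dimension at least [m]; take the first [m]
    vectors of an orthonormal basis of it. *)
Lemma coisometry_in_kernel m p s (Y : 'M[C]_(p, s)) : (m + s <= p)%N ->
  exists2 K : 'M[C]_(m, p), K \is unitarymx & K *m Y = 0.
Proof.
move=> msp.
have rk : (m <= \rank (kermx Y))%N.
  rewrite mxrank_ker (leq_trans _ (leq_sub2l p (rank_leq_col Y))) //.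
  by rewrite -{1}(addnK s m) leq_sub2r.
set B := schmidt (row_base (kermx Y)).
have /unitarymxP BU : B \is unitarymx by rewrite schmidt_unitarymx // rank_leq_col.
have BY : B *m Y = 0.
  by apply/sub_kermxP; rewrite eqmx_schmidt_free ?row_base_free // eq_row_base.
exists (rowsub (widen_ord rk) B).
  apply/unitarymxP; apply/matrixP => i j.
  have /matrixP /(_ (widen_ord rk i) (widen_ord rk j)) := BU.
  rewrite !mxE -[i == j]/(widen_ord rk i == widen_ord rk j) => <-.
  by apply: eq_bigr => l _; rewrite !mxE.
apply/matrixP => i j; have /matrixP /(_ (widen_ord rk i) j) := BY.
rewrite !mxE => h; rewrite -[RHS]h.
by apply: eq_bigr => l _; rewrite !mxE.
Qed.

Lemma sqnorm_row_mx m p (x : 'rV[C]_m) (y : 'rV_p) :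
  sqnorm (row_mx x y) = sqnorm x + sqnorm y.
Proof.
by rewrite /sqnorm big_split_ord /=; congr (_ + _); apply: eq_bigr => i _;
  rewrite ?row_mxEl ?row_mxEr.
Qed.

(** Choose an isometric copy [K] of the [m]-dimensional space inside the left
    kernel of the stacked matrix of [Y1] and [Y2], which has dimension at least
    [m] because [s <= m]; compress the stacked matrix of [T1] and [T2] to it,
    and perturb that square matrix.  The bounds do not depend on [m] and [s],
    so that they can be used for all atoms at once. *)
Lemma block_perturbation m s (Y1 Y2 : 'M[C]_(m, s)) (T1 T2 : 'M[C]_m) (e : C) :
  (s <= m)%N -> 0 < e ->
  exists D1 D2 B1 B2 : 'M[C]_m,
  [/\ B1 *m (T1 + D1) + B2 *m (T2 + D2) = 1%:M, B1 *m Y1 + B2 *m Y2 = 0,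
    forall x, sqnorm (x *m D1) <= (2 * e) ^+ 2 * sqnorm x /\
      sqnorm (x *m D2) <= (2 * e) ^+ 2 * sqnorm x &
    forall x, sqnorm (x *m B1) <= e ^- 2 * sqnorm x /\
      sqnorm (x *m B2) <= e ^- 2 * sqnorm x].
Proof.
move=> sm e0.
have [|K KU KY] := @coisometry_in_kernel m _ _ (col_mx Y1 Y2).
  by rewrite leq_add2l.
have /unitarymxP KK := KU.
have [D [G [GD Dle Gle]]] := near_invertible (K *m col_mx T1 T2) e0.
pose DD := K^t* *m D; pose B := G *m K.
exists (usubmx DD), (dsubmx DD), (lsubmx B), (rsubmx B).
have DDle (x : 'rV_(m + m)) : sqnorm (x *m DD) <= (2 * e) ^+ 2 * sqnorm x.
  rewrite mulmxA (le_trans (Dle _)) // ler_wpM2l ?sqnorm_isometry_le //.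
  by rewrite exprn_ge0 // mulr_ge0 ?ltW.
have Ble x : sqnorm (x *m B) <= e ^- 2 * sqnorm x.
  by rewrite mulmxA sqnorm_coisometry.
split.
- rewrite -mul_row_col -add_col_mx hsubmxK vsubmxK /B /DD mulmxDr.
  by rewrite -!mulmxA (mulmxA K (K^t*)) KK mul1mx -mulmxDr.
- by rewrite -mul_row_col hsubmxK -mulmxA KY mulmx0.
- move=> x; split.
    have := DDle (row_mx x 0); rewrite -[in X in X -> _](vsubmxK DD) mul_row_col.
    by rewrite mul0mx addr0 sqnorm_row_mx sqnorm0 addr0.
  have := DDle (row_mx 0 x); rewrite -[in X in X -> _](vsubmxK DD) mul_row_col.
  by rewrite mul0mx add0r sqnorm_row_mx sqnorm0 add0r.
- move=> x; have := Ble x.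
  rewrite -[in X in X -> _](hsubmxK B) mul_mx_row sqnorm_row_mx => h.
  by split; apply: le_trans h; rewrite ?lerDl ?lerDr sqnorm_ge0.
Qed.

End Matrices.

(** * Finite orthonormal families in a Hilbert space *)

Section HilbertGeometry.
Context {R : realType} {H : hilbertType R}.
Implicit Types (x y z : H) (f g e : nat -> H) (c : nat -> R[i]) (M : set H).

Lemma innerC x y : inner x y = Num.conj (inner y x).
Proof. by rewrite hermC /= expr0 mul1r. Qed.

Lemma inner_eq0C x y : inner x y = 0 -> inner y x = 0.
Proof. by rewrite innerC => /(congr1 Num.conj); rewrite conjCK rmorph0. Qed.

Lemma inner0l y : inner (0 : H) y = 0. Proof. exact: linear0l. Qed.
Lemma inner0r x : inner x (0 : H) = 0. Proof. exact: linear0r. Qed.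
Lemma innerDl x y z : inner (x + y) z = inner x z + inner y z.
Proof. exact: linearDl. Qed.
Lemma innerBl x y z : inner (x - y) z = inner x z - inner y z.
Proof. exact: linearBl. Qed.
Lemma innerNl x y : inner (- x) y = - inner x y.
Proof. exact: linearNl. Qed.
Lemma innerDr x y z : inner x (y + z) = inner x y + inner x z.
Proof. exact: linearDr. Qed.
Lemma innerNr x y : inner x (- y) = - inner x y.
Proof. exact: linearNr. Qed.
Lemma innerZl a x y : inner (a *: x) y = a * inner x y.
Proof. exact: linearZl_LR. Qed.
Lemma inner_suml (I : Type) (r : seq I) (P : pred I) (F : I -> H) y :
  inner (\sum_(i <- r | P i) F i) y = \sum_(i <- r | P i) inner (F i) y.
Proof. exact: linear_sumlz. Qed.

Lemma pythagoras x y : inner x y = 0 -> `|x + y| ^+ 2 = `|x| ^+ 2 + `|y| ^+ 2.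
Proof. by move=> xy; rewrite -!inner_norm; apply: hnormDd. Qed.

Definition lin_span (d : nat) f : set H :=
  [set x | exists c, x = \sum_(i < d) c i *: f i].

Definition orthonormal_fam (d : nat) g :=
  forall i j, (i < d)%N -> (j < d)%N -> inner (g i) (g j) = (i == j)%:R.

Lemma lin_span_subspace d f : subspace_set (lin_span d f).
Proof.
split; first by exists (fun=> 0); rewrite big1 // => i _; rewrite scale0r.
move=> a _ _ [c ->] [c' ->]; exists (fun i => a * c i + c' i).
rewrite scaler_sumr -big_split; apply: eq_bigr => i _ /=.
by rewrite scalerA -scalerDl.
Qed.

Lemma subspaceZ M a x : subspace_set M -> M x -> M (a *: x).
Proof. by move=> [M0 Ml] Mx; rewrite -[_ *: _]addr0; apply: Ml. Qed.

Lemma subspaceD M x y : subspace_set M -> M x -> M y -> M (x + y).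
Proof. by move=> [M0 Ml] Mx My; rewrite -[x]scale1r; apply: Ml. Qed.

Lemma subspaceB M x y : subspace_set M -> M x -> M y -> M (x - y).
Proof.
by move=> sM Mx My; rewrite -scaleN1r; apply: subspaceD => //; apply: subspaceZ.
Qed.

Lemma lin_span_min d f M : subspace_set M -> (forall i, (i < d)%N -> M (f i)) ->
  lin_span d f `<=` M.
Proof.
move=> sM Mf _ [c ->]; apply: (big_ind M) => [|x y|i _]; first by case: sM.
  exact: (subspaceD sM).
by apply: subspaceZ => //; apply: Mf.
Qed.

Lemma lin_span_gen d f i : (i < d)%N -> lin_span d f (f i).
Proof.
move=> id; exists (fun j => (j == i)%:R).
rewrite (bigD1 (Ordinal id)) //= eqxx scale1r big1 ?addr0 // => j ji.
by rewrite -(inj_eq val_inj) /= in ji; rewrite (negPf ji) scale0r.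
Qed.

Definition proj_fam (d : nat) g x := \sum_(i < d) inner x (g i) *: g i.

Section Orthonormal.
Context (d : nat) (g : nat -> H) (on : orthonormal_fam d g).

Lemma inner_lin_comb c j : (j < d)%N ->
  inner (\sum_(i < d) c i *: g i) (g j) = c j.
Proof.
move=> jd; rewrite inner_suml (bigD1 (Ordinal jd)) //= innerZl on // eqxx mulr1.
rewrite big1 ?addr0 // => i ij; rewrite innerZl on //.
by rewrite -(inj_eq val_inj) /= in ij; rewrite (negPf ij) mulr0.
Qed.

Lemma proj_fam_span x : lin_span d g (proj_fam d g x).
Proof. by exists (fun i => inner x (g i)). Qed.

Lemma orthogonal_span x z : (forall j, (j < d)%N -> inner x (g j) = 0) ->
  lin_span d g z -> inner x z = 0.
Proof.
move=> xg [c ->]; apply: inner_eq0C; rewrite inner_suml big1 // => i _.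
by rewrite innerZl (inner_eq0C (xg _ _)) ?mulr0.
Qed.

Lemma proj_fam_orth x z : lin_span d g z -> inner (x - proj_fam d g x) z = 0.
Proof.
apply: orthogonal_span => j jd.
by rewrite innerBl (inner_lin_comb (fun i => inner x (g i))) // subrr.
Qed.

Lemma norm_lin_comb c : `|\sum_(i < d) c i *: g i| ^+ 2 = \sum_(i < d) `|c i| ^+ 2.
Proof.
rewrite -inner_norm inner_suml; apply: eq_bigr => i _.
by rewrite innerZl innerC inner_lin_comb // normCK.
Qed.

Lemma bessel x : \sum_(i < d) `|inner x (g i)| ^+ 2 <= `|x| ^+ 2.
Proof.
rewrite -(norm_lin_comb (fun i => inner x (g i))).
rewrite -[in leRHS](subrK (proj_fam d g x) x) pythagoras.
  by rewrite lerDr exprn_ge0.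
exact/proj_fam_orth/proj_fam_span.
Qed.

End Orthonormal.

Lemma orthonormal_extend d g x :
  orthonormal_fam d g -> x != proj_fam d g x ->
  orthonormal_fam d.+1 (fun i => if (i < d)%N then g i
    else `|x - proj_fam d g x|^-1 *: (x - proj_fam d g x)).
Proof.
move=> on xP; set y := x - _; have y0 : `|y| != 0 by rewrite normr_eq0 subr_eq0.
have yg i : (i < d)%N -> inner y (g i) = 0.
  by move=> id; apply: (proj_fam_orth on); apply: lin_span_gen.
have yy : inner (`|y|^-1 *: y) (`|y|^-1 *: y) = 1.
  rewrite inner_norm normrZ normfV normr_id.
  by rewrite mulVf // expr1n.
move=> i j; rewrite ltnS leq_eqVlt => /orP[/eqP->|i_d];
  rewrite ltnS leq_eqVlt => /orP[/eqP->|j_d].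
- by rewrite ltnn yy eqxx.
- by rewrite ltnn j_d innerZl yg // mulr0 gtn_eqF.
- by rewrite ltnn i_d innerC innerZl yg // mulr0 rmorph0 ltn_eqF.
- by rewrite i_d j_d on.
Qed.

(** Induction on [d].  Either [M] lies in the span of the first [d] vectors,
    or it contains an [x] outside of it; then every [z] in [M] differs by a
    multiple of [x] from a vector of [M] in that span, so one more Gram-Schmidt
    step gives the basis. *)
Lemma subspace_orthonormal_basis d f M : subspace_set M ->
  M `<=` lin_span d f ->
  exists r g, orthonormal_fam r g /\ M = lin_span r g.
Proof.
elim: d M => [|d IH] M sM Mf.
  exists 0%N, f; split=> //; apply/seteqP; split=> //.
  by apply: lin_span_min.
have sM0 : subspace_set (M `&` lin_span d f).
  have [f0 fl] := lin_span_subspace d f; case: sM => M0 Ml.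
  by split=> [|a x y [? ?] [? ?]]; split; auto.
have [|r [g [on M0E]]] := IH _ sM0; first by move=> x [].

have [Mfd|] := pselect (M `<=` lin_span d f).
  by exists r, g; split=> //; rewrite -M0E; apply/esym/setIidl.
move=> /existsNP[x /not_implyP[Mx xf]].
have gM : lin_span r g `<=` M by rewrite -M0E => z [].
have gf : lin_span r g `<=` lin_span d f by rewrite -M0E => z [].
have xP : x != proj_fam r g x.
  by apply/eqP => xE; apply: xf; rewrite xE; apply/gf/proj_fam_span.
have onh := orthonormal_extend on xP.
set y := x - _ in onh; set h := (fun i => if _ then _ else _) in onh.
exists r.+1, h; split=> //; apply/seteqP; split; last first.
  apply: lin_span_min => // i _; rewrite /h; case: ifP => ir.
    exact/gM/lin_span_gen.
  by apply: subspaceZ => //; apply: subspaceB => //; apply/gM/proj_fam_span.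
have sh := lin_span_subspace r.+1 h.
have gh : lin_span r g `<=` lin_span r.+1 h.
  apply: lin_span_min => // i ir.
  by have := @lin_span_gen r.+1 h i (leqW ir); rewrite /h ir.
have hx : lin_span r.+1 h x.
  rewrite -(subrK (proj_fam r g x) x) -/y; apply: subspaceD => //; last first.
    exact/gh/proj_fam_span.
  have := @lin_span_gen r.+1 h r (ltnSn r); rewrite /h ltnn => /(subspaceZ `|y| sh).
  by rewrite scalerA mulfV ?scale1r // normr_eq0 subr_eq0.
have [b xb] := Mf _ Mx.
have bd : b d != 0.
  apply/eqP => b0; apply: xf; exists b.
  by rewrite xb big_ord_recr /= b0 scale0r addr0.
move=> z Mz; have [c zc] := Mf _ Mz.
rewrite -(subrK ((c d / b d) *: x) z); apply: subspaceD => //; last exact: subspaceZ.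
apply: gh; rewrite -M0E; split.
  by apply: subspaceB => //; apply: subspaceZ.
exists (fun i => c i - c d / b d * b i).
rewrite zc {1}xb !big_ord_recr /= scalerDr scalerA divfK // opprD addrACA subrr addr0.
rewrite scaler_sumr -sumrB; apply: eq_bigr => i _.
by rewrite scalerA scalerBl.
Qed.

(** If [q < p], the matrix of coordinates of [f] has a nonzero left kernel,
    which contradicts the freeness of [f]. *)
Lemma free_le_span p q (f : 'I_p -> H) g :
  (forall c : 'I_p -> R[i], \sum_(i < p) c i *: f i = 0 -> forall i, c i = 0) ->
  (forall i, lin_span q g (f i)) -> (p <= q)%N.
Proof.
move=> free /choice[a fa]; pose A := \matrix_(i < p, j < q) a i j.
rewrite leqNgt; apply/negP => qp.
have : kermx A != 0.
  rewrite kermx_eq0 -row_leq_rank -ltnNge; exact: leq_ltn_trans (rank_leq_col _) qp.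
move=> /matrix0Pn[k [l kl]]; move/eqP: kl; apply.
apply: (free (fun i => kermx A k i)).
under eq_bigr do rewrite fa scaler_sumr.
rewrite exchange_big /= big1 // => j _.
under eq_bigr do rewrite scalerA.
rewrite -scaler_suml (_ : \sum_i _ = (kermx A *m A) k j).
  by rewrite mulmx_ker mxE scale0r.
by rewrite mxE; apply: eq_bigr => i _; rewrite !mxE.
Qed.

Lemma has_dim_orthonormal_basis M n : has_dim M n ->
  exists2 g, orthonormal_fam n g & M = lin_span n g.
Proof.
move=> [f [free ME]].
pose f' i := if insub i is Some j then f j else 0.
pose ext (c : 'I_n -> R[i]) i := if insub i is Some j then c j else 0.
have f'E (c : 'I_n -> R[i]) (c' : nat -> R[i]) : (forall i : 'I_n, c i = c' i) ->
    \sum_(i < n) c i *: f i = \sum_(i < n) c' i *: f' i.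
  by move=> cc; apply: eq_bigr => i _; rewrite cc /f' valK.
have Mf' : M = lin_span n f'.
  rewrite ME; apply/seteqP; split=> [_ [c _ <-]|_ [c ->]].
    by exists (ext c); apply: (f'E c (ext c)) => i; rewrite /ext valK.
  by exists (fun i : 'I_n => c i) => //; apply: (f'E _ c).
have [|//|r [g [on Mg]]] := @subspace_orthonormal_basis n f' M.
- by rewrite Mf'; apply: lin_span_subspace.
- by rewrite Mf'.
suff rn : r = n by rewrite -rn; exists g.
apply/eqP; rewrite eqn_leq; apply/andP; split.
  apply: (@free_le_span r n (fun i => g i) f') => [c c0 j|i].
    pose c' i := if insub i is Some j then c j else 0.
    have c'E i : c' (val i) = c i by rewrite /c' valK.
    rewrite -c'E -(inner_lin_comb on c' (ltn_ord j)).
    by under eq_bigr do rewrite c'E; rewrite c0 inner0l.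
  by rewrite -Mf' Mg; apply: lin_span_gen.
apply: (@free_le_span n r f g free) => i; rewrite -Mg Mf'.
by have := lin_span_gen f' (ltn_ord i); rewrite {2}/f' valK.
Qed.

End HilbertGeometry.

(** * Complete orthonormal systems and operators given by coordinates *)

Section CompleteSystems.
Context {R : realType} {H : hilbertType R}.
Implicit Types (x y z : H) (f g e : nat -> H) (c : nat -> R[i]) (M : set H).

Definition orthonormal_seq e := forall i j, inner (e i) (e j) = (i == j)%:R.

Definition total_seq e := forall x, (forall i, inner x (e i) = 0) -> x = 0.

Lemma orthonormal_seq_fam e d : orthonormal_seq e -> orthonormal_fam d e.
Proof. by move=> on i j _ _; apply: on. Qed.

(** Bessel's inequality for a single vector; this special case of the
    Cauchy-Schwarz inequality gives the continuity of coordinates. *)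
Lemma norm_inner_unit x y : `|y| = 1 -> `|inner x y| <= `|x|.
Proof.
move=> y1; have on : orthonormal_fam 1 (fun=> y).
  by move=> [|//] [|//] _ _; rewrite inner_norm y1 expr1n.
have := bessel on x; rewrite big_ord1.
by rewrite ler_pXn2r // nnegrE.
Qed.

Lemma norm_orthonormal e i : orthonormal_seq e -> `|e i| = 1.
Proof.
move=> on; apply/eqP; rewrite -(@eqrXn2 _ 2) ?ler01 ?normr_ge0 //.
by rewrite -inner_norm on eqxx expr1n.
Qed.

(** The partial sums form a Cauchy sequence, as their squared norms increase
    and are bounded.  The last clause exhibits the vector as a limit of the
    partial sums, for use where [e] is not total. *)
Lemma riesz_fischer e c (b : R[i]) : orthonormal_seq e -> 0 <= b ->
  (forall K, \sum_(a < K) `|c a| ^+ 2 <= b ^+ 2) ->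
  exists x, [/\ forall a, inner x (e a) = c a, `|x| <= b &
    forall d : R[i], 0 < d -> exists K, `|x - \sum_(a < K) c a *: e a| < d].
Proof.
move=> on b0 cb; pose u K : H := \sum_(a < K) c a *: e a.
have u_norm K : `|u K| ^+ 2 = \sum_(a < K) `|c a| ^+ 2.
  by apply: norm_lin_comb; apply: orthonormal_seq_fam.
have uP m k : `|u (k + m)%N| ^+ 2 = `|u k| ^+ 2 + `|u (k + m)%N - u k| ^+ 2.
  rewrite -pythagoras ?[u k + _]addrC ?subrK //; apply: inner_eq0C.
  apply: (@orthogonal_span _ _ k e); last by exists c.
  move=> j jk; rewrite innerBl !inner_lin_comb ?subrr //;
    rewrite ?(leq_trans jk) ?leq_addr //; exact: orthonormal_seq_fam.
pose s (K : nat) : R := complex.Re (`|u K| ^+ 2).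
have sE K : (s K)%:C%C = `|u K| ^+ 2 by rewrite RRe_real ?realX ?normr_real.
have s_incr : nondecreasing_seq s.
  move=> k l /subnKC <-; rewrite -lecR !sE uP lerDl exprn_ge0 //.
have s_bnd : has_ubound (range s).
  exists (complex.Re (b ^+ 2)) => _ [K _ <-].
  rewrite -lecR sE RRe_real ?realX ?ger0_real // u_norm; exact: cb.
have s_cvg := nondecreasing_is_cvgn s_incr s_bnd.
have u_cvg : cvg (u @ \oo).
  apply: cauchy_cvg; apply/cauchy_exP => d d0.
  have dE : (complex.Re d)%:C%C = d by rewrite RRe_real ?gtr0_real.
  have d0' : 0 < complex.Re d by rewrite -ltcR dE.
  have d2 : 0 < complex.Re d ^+ 2 by rewrite exprn_gt0.
  have /cvgrPdist_lt /(_ _ d2) [N _ Ns] := s_cvg.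
  exists (u N); exists N => // k /= Nk; rewrite -ball_normE /= distrC.
  rewrite -(@ltr_pXn2r _ 2) ?nnegrE ?(ltW d0) //.
  have := uP (k - N)%N N; rewrite subnKC // => /eqP.
  rewrite addrC -subr_eq => /eqP <-.
  rewrite -!sE -dE -rmorphXn -rmorphB /= ltcR.
  have := Ns N (leqnn N); rewrite /= ger0_norm; last first.
    by rewrite subr_ge0 (nondecreasing_cvgn_le s_incr).
  apply: le_lt_trans; rewrite lerB //.
  exact: nondecreasing_cvgn_le.
have near_u (d : R[i]) : 0 < d ->
    exists N, forall k, (N <= k)%N -> `|lim (u @ \oo) - u k| < d.
  by move=> d0; have /cvgrPdist_lt /(_ _ d0) [N _ Ns] := u_cvg; exists N.
exists (lim (u @ \oo)); split.
- move=> a; apply/eqP; rewrite -subr_eq0 -normr_le0; apply/ler_addgt0Pl => d d0.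
  have [N Nu] := near_u _ d0; rewrite addr0.
  have aK : (a < maxn N a.+1)%N by rewrite leq_max leqnn orbT.
  rewrite -(inner_lin_comb (@orthonormal_seq_fam e (maxn N a.+1) on) c aK).
  rewrite -innerBl (le_trans (norm_inner_unit _ (norm_orthonormal _ on))) //.
  by apply/ltW/Nu; rewrite leq_maxl.
- apply/ler_addgt0Pl => d d0; have [N Nu] := near_u _ d0.
  rewrite -(subrK (u N) (lim _)) (le_trans (ler_normD _ _)) // lerD ?(ltW (Nu _ _)) //.
  by rewrite -(@ler_pXn2r _ 2) ?nnegrE // u_norm.
- by move=> d d0; have [N Nu] := near_u _ d0; exists N; apply: Nu.
Qed.

Section CompleteSystem.
Context (e : nat -> H) (on : orthonormal_seq e) (tot : total_seq e).

Lemma total_ext x y : (forall a, inner x (e a) = inner y (e a)) -> x = y.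
Proof.
move=> xy; apply/eqP; rewrite -subr_eq0; apply/eqP/tot => a.
by rewrite innerBl xy subrr.
Qed.

Lemma proj_fam_dense x (d : R[i]) : 0 < d ->
  exists K, `|x - proj_fam K e x| < d.
Proof.
move=> d0.
have [y [ye _ yP]] := @riesz_fischer e (fun a => inner x (e a)) _ on (normr_ge0 x)
  (fun K => bessel (@orthonormal_seq_fam e K on) x).
by have [K] := yP d d0; rewrite (total_ext ye); exists K.
Qed.

(** Additivity and homogeneity follow from those of the coordinates, because
    a vector is determined by its coordinates. *)
Lemma operator_of_coefs (phi : H -> nat -> R[i]) (b : R[i]) :
  (forall (t : R[i]) x y a, phi (t *: x + y) a = t * phi x a + phi y a) ->
  0 <= b ->
  (forall x K, \sum_(a < K) `|phi x a| ^+ 2 <= (b * `|x|) ^+ 2) ->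
  exists T : H -> H, [/\ bounded_operator T,
    forall x a, inner (T x) (e a) = phi x a & forall x, `|T x| <= b * `|x|].
Proof.
move=> phil b0 phib.
have /choice[T TP] : forall x, exists y,
    (forall a, inner y (e a) = phi x a) /\ `|y| <= b * `|x|.
  move=> x; have [y [ye yb _]] := @riesz_fischer e (phi x) _ on
    (mulr_ge0 b0 (normr_ge0 x)) (phib x).
  by exists y.
exists T; split=> [|x a|x]; [|by case: (TP x)|by case: (TP x)].
split=> [t x y|]; last by exists b => x; case: (TP x).
by apply: total_ext => a; rewrite innerDl innerZl !(proj1 (TP _)) phil.
Qed.

End CompleteSystem.

Lemma bounded_operatorD (T : H -> H) x y : bounded_operator T -> T (x + y) = T x + T y.
Proof. by move=> [Tl _]; have := Tl 1 x y; rewrite !scale1r. Qed.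

Lemma bounded_operatorB (T : H -> H) x y : bounded_operator T -> T (x - y) = T x - T y.
Proof. by move=> bT; rewrite addrC -scaleN1r bT.1 scaleN1r addrC. Qed.

Lemma bounded_operator_lin_comb (T : H -> H) (I : Type) (r : seq I) (P : pred I)
    (c : I -> R[i]) (f : I -> H) : bounded_operator T ->
  T (\sum_(i <- r | P i) c i *: f i) = \sum_(i <- r | P i) c i *: T (f i).
Proof.
move=> bT; elim/big_rec2: _ => [|i _ y _ <-]; first exact: bounded_operator0.
by rewrite bounded_operatorD // bounded_operatorZ.
Qed.

Lemma bounded_operator_ext e (S T : H -> H) : orthonormal_seq e -> total_seq e ->
  bounded_operator S -> bounded_operator T -> (forall a, S (e a) = T (e a)) ->
  forall x, S x = T x.
Proof.
move=> on tot bS bT ST x.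
have STP K y : S (proj_fam K e y) = T (proj_fam K e y).
  by rewrite !bounded_operator_lin_comb //; under eq_bigr do rewrite ST.
apply/eqP; rewrite -subr_eq0 -normr_le0; apply/ler_addgt0Pl => d d0; rewrite addr0.
set q := opnorm S + opnorm T + 1.
have q0 : 0 < q by rewrite ltr_wpDl ?ltr01 // addr_ge0 // opnorm_ge0.
have [K xK] := proj_fam_dense on tot x (divr_gt0 d0 q0).
set y := proj_fam K e x in xK.
have -> : S x - T x = S (x - y) - T (x - y).
  rewrite (bounded_operatorB _ _ bS) (bounded_operatorB _ _ bT) STP.
  by rewrite opprB addrA subrK.
rewrite (le_trans (ler_normB _ _)) //.
apply: (@le_trans _ _ (q * `|x - y|)).
  rewrite !mulrDl mul1r ler_wpDr // lerD // opnorm_ub //.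
by rewrite mulrC -ler_pdivlMr // ltW.
Qed.

End CompleteSystems.

(** * An orthonormal basis adapted to a tower of finite-dimensional subspaces *)

Section AdaptedBasis.
Context {R : realType} {H : hilbertType R}.
Implicit Types (x y z : H) (f g e : nat -> H) (M : set H).

Lemma orth_proj_unique M x y : subspace_set M -> M y ->
  (forall z, M z -> inner (x - y) z = 0) -> orth_proj M x = y.
Proof.
move=> sM My xy; apply: xget_unique => // y' [My' xy'].
apply/eqP; rewrite -subr_eq0 -normr_eq0 -sqrf_eq0 -inner_norm; apply/eqP.
have My'y : M (y' - y) by apply: subspaceB.
have {1}-> : y' - y = (x - y) - (x - y') by rewrite opprB [RHS]addrC addrA subrK.
by rewrite innerBl xy // xy' // subrr.
Qed.

Lemma orth_proj_span d g x : orthonormal_fam d g ->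
  orth_proj (lin_span d g) x = proj_fam d g x.
Proof.
move=> on; apply: orth_proj_unique; first exact: lin_span_subspace.
  exact: proj_fam_span.
by move=> z; apply: proj_fam_orth.
Qed.

(** The lists [g k] of length [m k] are concatenated; [blk a] is the number of
    the list that contains the entry of index [a]. *)
Lemma flatten_blocks (s m : nat -> nat) (g : nat -> nat -> H) :
  s 0%N = 0%N -> (forall k, s k.+1 = s k + m k)%N -> (forall k, 0 < m k)%N ->
  exists e : nat -> H, exists blk : nat -> nat,
    (forall k i, (i < m k)%N -> e (s k + i)%N = g k i) /\
    (forall a, s (blk a) <= a < s (blk a).+1)%N.
Proof.
move=> s0 sS m0.
have s_ge k : (k <= s k)%N by elim: k => // k IH; rewrite sS -addn1 leq_add.
have exb a : exists k, (a < s k.+1)%N by exists a; apply: s_ge.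
pose blk a := ex_minn (exb a).
have blkP a : (s (blk a) <= a < s (blk a).+1)%N.
  rewrite /blk; case: ex_minnP => k -> kmin; rewrite andbT leqNgt; apply/negP.
  case: k kmin => [|k] kmin; first by rewrite s0.
  by move=> /kmin; rewrite ltnn.
have s_homo : {homo s : k l / (k <= l)%N}.
  by apply: homo_leq => // [? ? ?|k]; [apply: leq_trans|rewrite sS leq_addr].
exists (fun a => g (blk a) (a - s (blk a))%N), blk; split=> // k i im.
have -> : blk (s k + i)%N = k.
  have /andP[lo hi] := blkP (s k + i)%N; apply/eqP.
  rewrite eqn_leq leqNgt [X in _ && X]leqNgt.
  apply/andP; split; apply/negP => kb.
    have := leq_trans (s_homo _ _ kb) lo.
    by rewrite sS leqNgt ltn_add2l im.
  have := leq_trans hi (s_homo _ _ kb).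
  by rewrite ltnNge leq_addr.
by rewrite addKn.
Qed.

Section Tower.
Context (N : nat -> set H) (n : nat -> nat).
Context (N_subspace : forall k, subspace_set (N k)).
Context (N_zero : N 0%N = [set 0]) (N_lt : forall k, N k `<` N k.+1).
Context (N_infty : closure (\bigcup_k N k) = setT).
Context (rank_atom : forall k, (1 <= k)%N ->
  has_rank (orth_proj (N k) \- orth_proj (N k.-1)) (n k)).

Let N_mono k l : (k <= l)%N -> N k `<=` N l.
Proof.
elim: l => [|l IH]; first by rewrite leqn0 => /eqP->.
rewrite leq_eqVlt => /orP[/eqP->//|]; rewrite ltnS => /IH kl.
by apply: subset_trans kl _; case: (N_lt l).
Qed.

(** Given an [x] in [N k.+1], subtracting its projection on [N k] gives an
    element of the range of the [k+1]-st atom projection, because the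
    projection on [N k.+1] fixes [x].  So [N k.+1] lies in the sum of two
    finite-dimensional spaces. *)
Lemma tower_finite_dim k : exists r g, orthonormal_fam r g /\ N k = lin_span r g.
Proof.
elim: k => [|k [r [g [on Ng]]]].
  apply: (@subspace_orthonormal_basis _ _ 0 (fun=> 0)) => //.
  by rewrite N_zero => _ ->; exists (fun=> 0); rewrite big_ord0.
have [h onh Fh] := has_dim_orthonormal_basis (rank_atom (ltn0Sn k)).
pose f i := if (i < r)%N then g i else h (i - r)%N.
apply: (@subspace_orthonormal_basis _ _ (r + n k.+1) f) => // x Nx.
have sf := lin_span_subspace (r + n k.+1) f.
rewrite -(subrK (orth_proj (N k) x) x); apply: subspaceD => //.
  have : lin_span (n k.+1) h (x - orth_proj (N k) x).
    rewrite -Fh; exists x => //=; congr (_ - _); apply: orth_proj_unique => //.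
    by move=> z _; rewrite subrr inner0l.
  apply: lin_span_min => // i im.
  have := @lin_span_gen _ _ (r + n k.+1) f (r + i); rewrite ltn_add2l => /(_ im).
  by rewrite /f ltnNge leq_addr /= addKn.
rewrite Ng orth_proj_span //; have := proj_fam_span r g x.
apply: lin_span_min => // i ir.
have := @lin_span_gen _ _ (r + n k.+1) f i; rewrite ltn_addr // => /(_ isT).
by rewrite /f ir.
Qed.

(** [orth_proj] takes a default value when the orthogonal projection does not
    exist; this lemma shows that this does not occur for the spaces [N k]. *)
Lemma tower_orth_projP k x :
  N k (orth_proj (N k) x) /\ forall z, N k z -> inner (x - orth_proj (N k) x) z = 0.
Proof.
have [r [g [on ->]]] := tower_finite_dim k; rewrite orth_proj_span //; split.
  exact: proj_fam_span.
by move=> z; apply: proj_fam_orth.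
Qed.

Let atom k : set H := [set x | N k.+1 x /\ forall z, N k z -> inner x z = 0].

Lemma tower_atom_basis k : exists2 g, orthonormal_fam (n k.+1) g &
  atom k = lin_span (n k.+1) g.
Proof.
have [g on Fg] := has_dim_orthonormal_basis (rank_atom (ltn0Sn k)).
exists g => //; rewrite -Fg; apply/seteqP; split=> [x [Nx xN]|_ [x _ <-]].
  exists x => //=; rewrite (@orth_proj_unique (N k.+1) x x) //; last first.
    by move=> z _; rewrite subrr inner0l.
  rewrite (@orth_proj_unique (N k) x 0) ?subr0 //; first by case: (N_subspace k).
have [Nk1x xN1] := tower_orth_projP k.+1 x.
have [Nkx xN] := tower_orth_projP k x.
have NN := @N_mono k k.+1 (leqnSn k).
split=> /=; first by apply: subspaceB => //; apply: NN.
move=> z Nz; rewrite -(subrK x (orth_proj (N k.+1) x)) -addrA innerDl xN // addr0.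
rewrite -opprB innerNl; by rewrite xN1 ?oppr0 //; apply: NN.
Qed.

Lemma tower_rank_gt0 k : (0 < n k.+1)%N.
Proof.
rewrite lt0n; apply/eqP => n0; have [g _] := tower_atom_basis k; rewrite n0 => ag.
have [_ /existsNP[x /not_implyP[Nx xN]]] := N_lt k.
have [Px xP] := tower_orth_projP k x.
have : atom k (x - orth_proj (N k) x).
  by split=> //; apply: subspaceB => //; apply: N_mono Px.
rewrite ag => -[c]; rewrite big_ord0 => /eqP; rewrite subr_eq0 => /eqP xE.
by apply: xN; rewrite xE.
Qed.

Definition offset k := (\sum_(1 <= i < k.+1) n i)%N.

Lemma offsetS k : offset k.+1 = (offset k + n k.+1)%N.
Proof. by rewrite /offset big_nat_recr. Qed.

(** The basis concatenates orthonormal bases of the atoms.  It is total since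
    a vector orthogonal to all atoms is orthogonal to every [N k], hence to
    their union, which is dense. *)
Lemma adapted_basis : exists e : nat -> H, exists blk : nat -> nat,
  [/\ orthonormal_seq e, total_seq e,
    forall k x, N k x <-> (forall a, (offset k <= a)%N -> inner x (e a) = 0) &
    forall a, (offset (blk a) <= a < offset (blk a).+1)%N].
Proof.
have /choice[g gP] : forall k, exists g, orthonormal_fam (n k.+1) g /\
    atom k = lin_span (n k.+1) g.
  by move=> k; have [g ? ?] := tower_atom_basis k; exists g.
have s0 : offset 0 = 0%N by rewrite /offset big_geq.
have [e [blk [eE blkP]]] := flatten_blocks g s0 offsetS tower_rank_gt0.
have blkE a : exists2 i, (i < n (blk a).+1)%N & a = (offset (blk a) + i)%N.
  have /andP[lo hi] := blkP a; exists (a - offset (blk a))%N; last by rewrite subnKC.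
  by rewrite ltn_subLR // -offsetS.
have s_homo : {homo offset : k l / (k <= l)%N}.
  by apply: homo_leq => // [? ? ?|k]; [apply: leq_trans|rewrite offsetS leq_addr].
have e_atom a : atom (blk a) (e a).
  have [i im aE] := blkE a; have [_ ->] := gP (blk a).
  have -> : e a = g (blk a) i by rewrite {1}aE eE.
  exact: lin_span_gen.
have e_in k a : (a < offset k)%N -> N k (e a).
  move=> ak; have [Nea _] := e_atom a; apply: N_mono Nea.
  rewrite ltnNge; apply/negP => /s_homo kb; have /andP[lo _] := blkP a.
  by have := leq_trans ak (leq_trans kb lo); rewrite ltnn.
have e_orth k a z : (offset k <= a)%N -> N k z -> inner (e a) z = 0.
  move=> ka Nz; have [_ ->//] := e_atom a; apply: N_mono Nz.
  rewrite -ltnS ltnNge; apply/negP => /s_homo kb; have /andP[_ hi] := blkP a.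
  by have := leq_trans hi (leq_trans kb ka); rewrite ltnn.
have on : orthonormal_seq e.
  have on_lt a b : (blk a < blk b)%N -> inner (e b) (e a) = 0.
    move=> ab; have [_ ->//] := e_atom b.
    by have [Nea _] := e_atom a; apply: N_mono Nea.
  move=> a b; case: (ltngtP (blk a) (blk b)) => ab.
  - rewrite (inner_eq0C (on_lt _ _ ab)); case: eqP => // abE.
    by rewrite abE ltnn in ab.
  - by rewrite on_lt //; case: eqP => // abE; rewrite abE ltnn in ab.
  have [[i im aE] [j jm bE]] := (blkE a, blkE b); have [og _] := gP (blk a).
  rewrite -ab in jm bE; rewrite aE bE (eE _ _ im) (eE _ _ jm) og //.
  by rewrite eqn_add2l.
have tot : total_seq e.
  move=> x xe.
  have xN k z : N k z -> inner x z = 0.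
    elim: k z => [|k IH] z; first by rewrite N_zero => ->; rewrite inner0r.
    move=> Nz; have [Pz zP] := tower_orth_projP k z.
    rewrite -(subrK (orth_proj (N k) z) z) innerDr (IH _ Pz) addr0.
    have : atom k (z - orth_proj (N k) z).
      by split=> //; apply: subspaceB => //; apply: N_mono Pz.
    have [_ ->] := gP k; apply: orthogonal_span => i im.
    by rewrite -eE.
  apply/eqP; rewrite -normr_le0; apply/ler_addgt0Pl => d d0; rewrite addr0.
  (* A vector [y] of some [N k] near [x] is orthogonal to [x]. *)
  have : closure (\bigcup_k N k) x by rewrite N_infty.
  move=> /(_ _ (nbhsx_ballx x d d0)) [y [[k _ Nky]]].
  rewrite -ball_normE /= => /ltW; apply: le_trans.
  rewrite -(@ler_pXn2r _ 2) ?nnegrE // pythagoras ?normrN ?lerDl ?exprn_ge0 //.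
  by rewrite innerNr (xN _ _ Nky) oppr0.
exists e, blk; split=> // k x; split=> [Nx a ka|xe].
  by apply: inner_eq0C; apply: e_orth Nx.
suff <- : orth_proj (N k) x = x by case: (tower_orth_projP k x).
have [Px xP] := tower_orth_projP k x.
apply: (total_ext tot) => a; have [ak|ka] := ltnP a (offset k).
  apply/eqP; rewrite eq_sym -subr_eq0 -innerBl; apply/eqP/xP; exact: e_in.
by rewrite xe //; apply: inner_eq0C; apply: e_orth Px.
Qed.

End Tower.
End AdaptedBasis.

(** * Block triangular operators and the left stable rank *)

Lemma dense_ball (K : numFieldType) (T : pseudoMetricType K) (D : set T) :
  dense D <-> (forall x (r : K), 0 < r -> exists2 y, D y & ball x r y).
Proof.
split=> [dD x r r0|hD O [x Ox] oO].
  have [|y [yO Dy]] := dD (interior (ball x r)) _ (open_interior _).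
    by exists x; apply: nbhsx_ballx.
  by exists y => //; apply: interior_subset yO.
have /nbhs_ballP[r /= r0 rO] : nbhs x O by apply: open_nbhs_nbhs.
by have [y Dy xy] := hD x r r0; exists y; split => //; apply: rO.
Qed.

Lemma le0_geometric (R : realType) (x D : R[i]) : 0 <= x ->
  (forall J, x <= D / 2 ^+ J) -> x = 0.
Proof.
move=> x0 xD.
have D0 : 0 <= D by have := xD 0%N; rewrite expr0 divr1; apply: le_trans.
have xE : (complex.Re x)%:C%C = x by rewrite RRe_real ?ger0_real.
have DE : (complex.Re D)%:C%C = D by rewrite RRe_real ?ger0_real.
suff : complex.Re x <= 0.
  by rewrite -lecR xE => x0'; apply/le_anti; rewrite x0' x0.
rewrite leNgt; apply/negP => rx0.
have rD0 : 0 <= complex.Re D by rewrite -lecR DE.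
set q := complex.Re D / complex.Re x.
have q0 : 0 <= q by rewrite divr_ge0 // ltW.
have := xD (Num.bound q); rewrite ler_pdivlMr ?exprn_gt0 //.
rewrite -xE -DE -[2](rmorph_nat (real_complex R)) -rmorphXn -rmorphM /= lecR.
rewrite mulrC -ler_pdivlMr // -/q leNgt => /negP; apply.
apply: lt_le_trans (archi_boundP q0) _.
by rewrite -natrX ler_nat ltnW // ltn_expl.
Qed.

Section Triangular.
Context {R : realType} {H : hilbertType R} (NN : nest H) (N : nat -> set H).
Context (s : nat -> nat) (e : nat -> H).
Context (NN_def : nest_set NN = range N `|` [set setT]).
Context (on : orthonormal_seq e) (tot : total_seq e).
Context (NP : forall k x, N k x <-> (forall a, (s k <= a)%N -> inner x (e a) = 0)).
Implicit Types (T : nestAlg NN) (x y : H).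

Lemma nestAlg_coef0 T k x a : N k x -> (s k <= a)%N -> inner (T x) (e a) = 0.
Proof.
move=> Nx; have [_ TN] := nest_opP T.
suff /NP TNx : N k (T x) by apply: TNx.
by apply: (TN (N k)); [rewrite NN_def; left; exists k|exists x].
Qed.

Lemma basis_in_nest k a : (a < s k)%N -> N k (e a).
Proof.
move=> ak; apply/NP => b kb; rewrite on; case: eqP => // ab.
by rewrite ab ltnNge kb in ak.
Qed.

Lemma nestAlg_of_coefs (phi : H -> nat -> R[i]) (b : R[i]) :
  (forall (t : R[i]) x y a, phi (t *: x + y) a = t * phi x a + phi y a) ->
  0 <= b ->
  (forall x K, \sum_(a < K) `|phi x a| ^+ 2 <= (b * `|x|) ^+ 2) ->
  (forall k x a, N k x -> (s k <= a)%N -> phi x a = 0) ->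
  exists T : nestAlg NN,
    (forall x a, inner (T x) (e a) = phi x a) /\ `|T| <= b.
Proof.
move=> phil b0 phib phiN.
have [T [bT TE Tb]] := operator_of_coefs on tot phil b0 phib.
have Tin : T \in nest_pred NN.
  apply/asboolP; split=> // M; rewrite NN_def => -[[k _ <-]|->] // _ [x Nx <-].
  by apply/NP => a ka; rewrite TE; apply: phiN Nx ka.
by exists (NestAlg Tin); split => //; apply: opnorm_leP.
Qed.

Lemma nestAlg_ext (S T : nestAlg NN) : (forall a, S (e a) = T (e a)) -> S = T.
Proof.
move=> ST; apply: nestAlg_eqP.
by apply: bounded_operator_ext on tot _ _ ST; apply: nest_op_bounded.
Qed.

Lemma nest_lin_comb k x : N k x -> x = \sum_(a < s k) inner x (e a) *: e a.
Proof.
move=> /NP xN; apply: (total_ext tot) => a; have [ak|ka] := ltnP a (s k).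
  by rewrite (inner_lin_comb (orthonormal_seq_fam on) (fun a => inner x (e a))).
rewrite xN // inner_suml big1 // => i _.
by rewrite innerZl on ltn_eqF ?mulr0 // (leq_trans (ltn_ord i)).
Qed.

(** On the finite-dimensional invariant subspace spanned by the first [s k]
    basis vectors, a one-sided inverse is two-sided. *)
Lemma nestAlg_inverse_comm (s_unbounded : forall a, exists k, (a < s k)%N)
  (S T : nestAlg NN) : ba_mul S T = ba_one -> ba_mul T S = ba_one.
Proof.
move=> ST; apply: nestAlg_ext => b; have [k bk] := s_unbounded b.
pose mx (U : nestAlg NN) := \matrix_(i < s k, j < s k) inner (U (e i)) (e j).
have mxM (U V : nestAlg NN) : mx (ba_mul U V) = mx V *m mx U.
  apply/matrixP => i j; rewrite !mxE.
  have Nk : N k (V (e i)) by apply/NP => a; apply: nestAlg_coef0; apply: basis_in_nest.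
  rewrite [ba_mul U V _](_ : _ = U (V (e i))) // {1}(nest_lin_comb Nk).
  rewrite (bounded_operator_lin_comb _ _ _ _ (nest_op_bounded U)) inner_suml.
  by apply: eq_bigr => a _; rewrite innerZl !mxE.
have mx1 : mx ba_one = 1%:M.
  by apply/matrixP => i j; rewrite !mxE; apply: on.
have TS : mx (ba_mul T S) = 1%:M by rewrite mxM; apply: mulmx1C; rewrite -mxM ST.
apply: (total_ext tot) => a; have [ak|ka] := ltnP a (s k).
  by have /matrixP /(_ (Ordinal bk) (Ordinal ak)) := TS; rewrite -mx1 !mxE.
by rewrite !(nestAlg_coef0 _ (basis_in_nest bk)).
Qed.

Lemma Rg1_sub_Lg1 (s_unbounded : forall a, exists k, (a < s k)%N) :
  @Rg _ (nestAlg NN) 1 `<=` @Lg _ (nestAlg NN) 1.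
Proof.
move=> A [B]; rewrite big_ord1 => AB; exists B; rewrite big_ord1.
exact: nestAlg_inverse_comm.
Qed.

(** [v] is the image of [x] under the isometry that sends [e] to [e']. *)
Lemma orthonormal_preimage (e' : nat -> H) x : orthonormal_seq e' ->
  exists v, [/\ forall b, inner v (e' b) = inner x (e b), `|v| <= `|x| &
    forall y, `|y| = 1 -> (forall b, inner (e' b) y = 0) -> inner v y = 0].
Proof.
move=> on'.
have [v [ve vb vlim]] := @riesz_fischer _ _ e' (fun b => inner x (e b)) _ on'
  (normr_ge0 x) (fun K => bessel (orthonormal_seq_fam on) x).
exists v; split=> // y y1 e'y; apply/eqP; rewrite -normr_le0.
apply/ler_addgt0Pl => d d0; rewrite addr0; have [K vK] := vlim d d0.
set u := \sum_(a < K) _ in vK.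
have uy : inner u y = 0.
  by rewrite inner_suml big1 // => i _; rewrite innerZl e'y mulr0.
by rewrite -[inner v y]subr0 -uy -innerBl (le_trans (norm_inner_unit _ y1)) // ltW.
Qed.

Section SpreadShifts.
Context (m : nat).

(** The maps [spread i] are injective, have pairwise disjoint ranges avoiding
    [0], and satisfy [a <= spread i a]. *)
Definition spread (i : 'I_m) (a : nat) := (m * a + i).+1.

Lemma spread_eq i j a b : (spread i a == spread j b) = (i == j) && (a == b).
Proof.
apply/eqP/andP => [[]|[/eqP-> /eqP->] //].
have m0 : (0 < m)%N by apply: leq_ltn_trans (ltn_ord i).
move=> h; have ij : i = j :> nat.
  by move/(congr1 (modn^~ m)): h; rewrite !(mulnC m) !modnMDl !modn_small.
split; first by apply/eqP/val_inj.
by move/eqP: h; rewrite ij eqn_add2r eqn_pmul2l.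
Qed.

Lemma orthonormal_spread i : orthonormal_seq (fun a => e (spread i a)).
Proof. by move=> a b; rewrite on spread_eq eqxx. Qed.

(** [A 0 i] is the adjoint of the isometry sending [e a] to [e (spread i a)].
    It is triangular because [spread i a] is at least [a]. *)
Lemma spread_coisometries : exists A : 'rV[nestAlg NN]_m,
  forall i x a, inner (A 0 i x) (e a) = inner x (e (spread i a)).
Proof.
have /choice[A AP] : forall i : 'I_m, exists A : nestAlg NN,
    forall x a, inner (A x) (e a) = inner x (e (spread i a)).
  move=> i; have [|//|x K|k x a /NP xN ka|A [AP _]] :=
      @nestAlg_of_coefs (fun x a => inner x (e (spread i a))) 1.
  - by move=> t x y a; rewrite innerDl innerZl.
  - by rewrite mul1r; apply: (bessel (orthonormal_seq_fam (@orthonormal_spread i))).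
  - have m0 : (0 < m)%N by apply: leq_ltn_trans (ltn_ord i).
    apply: xN; rewrite /spread ltnW // ltnS (leq_trans ka) //.
    by rewrite (leq_trans (leq_pmull _ m0)) // leq_addr.
  by exists A.
by exists (\row_i A i) => i x a; rewrite mxE.
Qed.

(** The right inverse of the column [A] sends [w] to the sum of the images of
    the [w j] under the isometries adjoint to the [A 0 j]. *)
Lemma spread_right_inverse (A : 'rV[nestAlg NN]_m) (w : 'I_m -> H) :
  (forall i x a, inner (A 0 i x) (e a) = inner x (e (spread i a))) ->
  exists v, [/\ forall i, A 0 i v = w i, inner v (e 0) = 0 &
    `|v| <= \sum_i `|w i|].
Proof.
move=> AP.
have /choice[v vP] := fun j => orthonormal_preimage (w j) (@orthonormal_spread j).
exists (\sum_j v j); split.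
- move=> i; apply: (total_ext tot) => a; rewrite AP inner_suml (bigD1 i) //=.
  have [-> _ _] := vP i; rewrite big1 ?addr0 // => j ji.
  have [_ _] := vP j; apply; first exact: norm_orthonormal.
  by move=> b; rewrite on spread_eq (negPf ji).
- rewrite inner_suml big1 // => j _; have [_ _] := vP j; apply.
    exact: norm_orthonormal.
  by move=> b; rewrite on.
- rewrite (le_trans (ler_norm_sum _ _ _)) // ler_sum // => j _.
  by case: (vP j).
Qed.

(** The functional [phi] of the introduction contracts under the perturbation,
    hence vanishes, although its value at the image of [e 0] is [1]. *)
Lemma Lg_not_dense : (0 < m)%N -> ~ dense (@Lg _ (nestAlg NN) m).
Proof.
move=> m0 /dense_ball; have [A AP] := spread_coisometries.
(* With this radius, the [m] differences add up to at most [1/2]. *)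
have r0 : 0 < (2 * m%:R)^-1 :> R[i] by rewrite invr_gt0 mulr_gt0 // ltr0n.
move=> /(_ A _ r0) [A' [B BA] AA'].
have dA i : `|A' 0 i - A 0 i| <= (2 * m%:R)^-1.
  have [_ /(_ 0 i)] := AA'; rewrite -ball_normE /= distrC; exact: ltW.
have BAx x : \sum_i B 0 i (A' 0 i x) = x.
  have E : (\sum_i ba_mul (B 0 i) (A' 0 i) : nestAlg NN) x = x by rewrite BA.
  by rewrite -[RHS]E; elim/big_rec2: _ => // i y T _ ->.
pose phi (w : 'I_m -> H) := inner (\sum_i B 0 i (w i)) (e 0).
pose size1 (w : 'I_m -> H) : R[i] := \sum_i `|w i|.
have phi_contract w : exists2 w', phi w = phi w' & size1 w' <= size1 w / 2.
  have [v [Av v0 vw]] := spread_right_inverse w AP.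
  exists (fun i => (A 0 i - A' 0 i) v).
    apply/eqP; rewrite -subr_eq0 -innerBl -sumrB -[X in _ == X]v0; apply/eqP.
    rewrite (_ : \sum_i _ = v) // -[RHS]BAx; apply: eq_bigr => i _.
    rewrite -(bounded_operatorB _ _ (nest_op_bounded (B 0 i))) nestAlgDE nestAlgNE.
    by rewrite -Av opprB addrC subrK.
  apply: (@le_trans _ _ (\sum_(i < m) (2 * m%:R)^-1 * `|v|)).
    apply: ler_sum => i _; rewrite (le_trans (nestAlg_ub _ _)) // ler_wpM2r //.
    by rewrite distrC.
  rewrite sumr_const card_ord -[X in X <= _]mulr_natl mulrA invfM mulrCA.
  by rewrite mulfV ?pnatr_eq0 -?lt0n // mulr1 mulrC ler_wpM2r.
pose C := \sum_i `|B 0 i|.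
have phi_le J w : `|phi w| <= C * size1 w / 2 ^+ J.
  elim: J w => [|J IH] w.
    rewrite expr0 divr1 (le_trans (norm_inner_unit _ (norm_orthonormal _ on))) //.
    rewrite (le_trans (ler_norm_sum _ _ _)) // /size1 mulr_sumr ler_sum // => i _.
    rewrite (le_trans (nestAlg_ub _ _)) // ler_wpM2r // /C (bigD1 i) //= lerDl.
    exact: sumr_ge0.
  have [w' -> w'w] := phi_contract w; rewrite (le_trans (IH w')) //.
  rewrite exprS invfM mulrA ler_wpM2r ?invr_ge0 ?exprn_ge0 // -mulrA.
  by rewrite ler_wpM2l // sumr_ge0.
have : phi (fun i => A' 0 i (e 0)) = 0.
  by apply/eqP; rewrite -normr_eq0; apply/eqP/le0_geometric => // J; apply: phi_le.
by rewrite /phi BAx on eqxx => /eqP; rewrite oner_eq0.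
Qed.

End SpreadShifts.
End Triangular.

(** * Block diagonal perturbations and the right stable rank *)

Section Blocks.
Context {R : realType} {H : hilbertType R} (NN : nest H) (N : nat -> set H).
Context (s m : nat -> nat) (blk : nat -> nat) (e : nat -> H).
Context (NN_def : nest_set NN = range N `|` [set setT]).
Context (on : orthonormal_seq e) (tot : total_seq e).
Context (NP : forall k x, N k x <-> (forall a, (s k <= a)%N -> inner x (e a) = 0)).
Context (s0 : s 0%N = 0%N) (sS : forall k, s k.+1 = (s k + m k)%N).
Context (blkP : forall a, (s (blk a) <= a < s (blk a).+1)%N).

Let s_homo : {homo s : k l / (k <= l)%N}.
Proof. by apply: homo_leq => // [? ? ?|k]; [apply: leq_trans|rewrite sS leq_addr]. Qed.

Lemma blk_le a l : (blk a < l)%N = (a < s l)%N.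
Proof.
have /andP[lo hi] := blkP a; apply/idP/idP => [/s_homo|al].
  exact: leq_trans.
by rewrite ltnNge; apply/negP => /s_homo /leq_trans /(_ lo); rewrite leqNgt al.
Qed.

Lemma blk_offset k i : (i < m k)%N -> blk (s k + i)%N = k.
Proof.
move=> im; apply/eqP; rewrite eqn_leq -ltnS blk_le sS ltn_add2l im /=.
by rewrite leqNgt blk_le -leqNgt leq_addr.
Qed.

Lemma block_decomposition a : exists k (i : 'I_(m k)), a = (s k + i)%N.
Proof.
have /andP[lo hi] := blkP a; have im : (a - s (blk a) < m (blk a))%N.
  by rewrite ltn_subLR // -sS.
by exists (blk a), (Ordinal im); rewrite /= subnKC.
Qed.

Lemma sum_blocks (F : nat -> R[i]) L :
  \sum_(a < s L) F a = \sum_(k < L) \sum_(i < m k) F (s k + i)%N.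
Proof.
elim: L => [|L IH]; first by rewrite s0 !big_ord0.
by rewrite big_ord_recr /= -IH sS big_split_ord.
Qed.

Definition block_coefs k (x : H) : 'rV[R[i]]_(m k) :=
  \row_i inner x (e (s k + i)%N).

Lemma block_coefs_basis k (i : 'I_(m k)) : block_coefs k (e (s k + i)%N) = delta_mx 0 i.
Proof. by apply/rowP => j; rewrite !mxE on eqxx eqn_add2l eq_sym. Qed.

Lemma block_coefs_basis0 k l (i : 'I_(m k)) : k != l ->
  block_coefs l (e (s k + i)%N) = 0.
Proof.
move=> kl; apply/rowP => j; rewrite !mxE on; case: eqP => // /(congr1 blk).
by rewrite !blk_offset // => /eqP; rewrite (negPf kl).
Qed.

(** By orthogonality of the blocks, a uniform bound of the blocks bounds the
    operator.  In row convention: row [i] of [D k] lists the coordinates of the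
    image of the [i]-th basis vector of block [k]. *)
Lemma block_diagonal_operator (D : forall k, 'M[R[i]]_(m k)) (c : R[i]) : 0 <= c ->
  (forall k x, sqnorm (x *m D k) <= c ^+ 2 * sqnorm x) ->
  exists T : nestAlg NN, `|T| <= c /\
    forall k (i : 'I_(m k)), T (e (s k + i)%N) = \sum_j D k i j *: e (s k + j)%N.
Proof.
move=> c0 Dc.
pose phi x a : R[i] := if insub (a - s (blk a))%N is Some i
  then (block_coefs (blk a) x *m D (blk a)) 0 i else 0.
have phiE x k (i : 'I_(m k)) : phi x (s k + i)%N = (block_coefs k x *m D k) 0 i.
  have := blk_offset (ltn_ord i); rewrite /phi.
  move aE: (s k + i)%N => a ak; move: i aE; rewrite -ak => i aE.
  have -> : (a - s (blk a))%N = i by rewrite -{1}aE addKn.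
  by rewrite valK.
have [|//|x K|k x a Nx ka|T [TE Tc]] :=
    @nestAlg_of_coefs _ _ _ _ s _ NN_def on tot NP phi c.
- move=> t x y a; have [k [i ->]] := block_decomposition a; rewrite !phiE.
  have -> : block_coefs k (t *: x + y) = t *: block_coefs k x + block_coefs k y.
    by apply/rowP => j; rewrite !mxE innerDl innerZl.
  by rewrite mulmxDl -scalemxAl [in LHS]mxE [X in X + _]mxE.
- have /andP[_ /ltnW Ks] := blkP K.
  apply: (@le_trans _ _ (\sum_(a < s (blk K).+1) `|phi x a| ^+ 2)).
    rewrite -(subnKC Ks) big_split_ord /= lerDl; apply: sumr_ge0 => i _.
    exact: exprn_ge0.
  rewrite (sum_blocks (fun a => `|phi x a| ^+ 2)) exprMn.
  apply: (@le_trans _ _ (c ^+ 2 * \sum_(a < s (blk K).+1) `|inner x (e a)| ^+ 2)).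
    rewrite (sum_blocks (fun a => `|inner x (e a)| ^+ 2)) mulr_sumr.
    apply: ler_sum => k _; under eq_bigr do rewrite phiE.
    apply: le_trans (Dc k (block_coefs k x)) _; rewrite ler_wpM2l ?exprn_ge0 //.
    by apply: ler_sum => i _; rewrite mxE.
  by rewrite ler_wpM2l ?exprn_ge0 // (bessel (orthonormal_seq_fam on)).
- have [l [i aE]] := block_decomposition a; rewrite aE phiE.
  suff -> : block_coefs l x = 0 by rewrite mul0mx mxE.
  apply/rowP => j; rewrite !mxE; move/NP: Nx; apply.
  rewrite (leq_trans _ (leq_addr _ _)) // s_homo // leqNgt.
  by rewrite -(blk_offset (ltn_ord i)) -aE blk_le -leqNgt.
exists T; split=> // k i; apply: (total_ext tot) => a; rewrite TE inner_suml.
have [l [j ->]] := block_decomposition a; rewrite phiE.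
have [kl|kl] := eqVneq k l.
  rewrite -kl in j *; rewrite block_coefs_basis -rowE mxE (bigD1 j) //=.
  rewrite innerZl on eqxx mulr1 big1 ?addr0 // => j' jj'.
  by rewrite innerZl on eqn_add2l (inj_eq val_inj) (negPf jj') mulr0.
rewrite block_coefs_basis0 // mul0mx mxE big1 // => j' _.
rewrite innerZl on; case: eqP => [/(congr1 blk)|]; last by rewrite mulr0.
by rewrite !blk_offset // => /eqP; rewrite (negPf kl).
Qed.

(** The matrices [Y j k] and [T j k] hold the coordinates, in [N k] and in the
    atom that follows it, of the images under [A 0 j] of the basis of that atom.
    It suffices to evaluate the perturbed row on basis vectors: its coordinates
    below the atom vanish by [B Y = 0], those in the atom are given by
    [B (T + D) = 1], and those above vanish by triangularity. *)
Lemma Rg2_dense (s_le_m : forall k, (s k <= m k)%N) :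
  dense (@Rg _ (nestAlg NN) 2).
Proof.
(* [block_perturbation] moves the blocks by [2 * eps], which must stay below
   the radius [r]. *)
apply/dense_ball => A r r0; pose eps := r / 4.
have eps0 : 0 < eps by rewrite divr_gt0.
pose Y j k := \matrix_(i < m k, b < s k) inner (A 0 j (e (s k + i)%N)) (e b).
pose T j k := \matrix_(i < m k, b < m k)
  inner (A 0 j (e (s k + i)%N)) (e (s k + b)%N).
pose M4 k := ('M[R[i]]_(m k) * 'M[R[i]]_(m k) * ('M[R[i]]_(m k) * 'M[R[i]]_(m k)))%type.
pose good k (q : M4 k) := [/\
    q.2.1 *m (T 0 k + q.1.1) + q.2.2 *m (T 1 k + q.1.2) = 1%:M,
    q.2.1 *m Y 0 k + q.2.2 *m Y 1 k = 0,
    forall x, sqnorm (x *m q.1.1) <= (2 * eps) ^+ 2 * sqnorm x /\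
      sqnorm (x *m q.1.2) <= (2 * eps) ^+ 2 * sqnorm x &
    forall x, sqnorm (x *m q.2.1) <= eps^-1 ^+ 2 * sqnorm x /\
      sqnorm (x *m q.2.2) <= eps^-1 ^+ 2 * sqnorm x].
have exq k : exists q, @good k q.
  have [D1 [D2 [B1 [B2 [h1 h2 h3 h4]]]]] :=
    block_perturbation (Y 0 k) (Y 1 k) (T 0 k) (T 1 k) (s_le_m k) eps0.
  by exists (D1, D2, (B1, B2)); split=> //= x; rewrite exprVn.
have [q qP] : exists q : forall k, M4 k, forall k, good k (q k).
  by exists (fun k => projT1 (cid (exq k))) => k; apply: projT2 (cid (exq k)).
have eps2 : 0 <= 2 * eps by rewrite mulr_ge0 // ltW.
have epsV : 0 <= eps^-1 by rewrite invr_ge0 ltW.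
have [|D1 [D1c D1E]] := @block_diagonal_operator (fun k => (q k).1.1) _ eps2.
  by move=> k x; have [_ _ h _] := qP k; exact: (h x).1.
have [|D2 [D2c D2E]] := @block_diagonal_operator (fun k => (q k).1.2) _ eps2.
  by move=> k x; have [_ _ h _] := qP k; exact: (h x).2.
have [|B1 [_ B1E]] := @block_diagonal_operator (fun k => (q k).2.1) _ epsV.
  by move=> k x; have [_ _ _ h] := qP k; exact: (h x).1.
have [|B2 [_ B2E]] := @block_diagonal_operator (fun k => (q k).2.2) _ epsV.
  by move=> k x; have [_ _ _ h] := qP k; exact: (h x).2.
pose D j : nestAlg NN := if j == 0 :> 'I_2 then D1 else D2.
exists (\row_j (A 0 j + D j)).
  exists (\row_j if j == 0 :> 'I_2 then B1 else B2).
  have l01 : lift ord0 ord0 = 1 :> 'I_2 by apply: val_inj.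
  rewrite !big_ord_recl big_ord0 addr0 l01 !mxE /D /=.
  set S1 := A 0 0 + D1; set S2 := A 0 1 + D2.
  apply: (nestAlg_ext on tot) => a; have [k [i ->]] := block_decomposition a.
  have Nke (l : 'I_(m k)) : N k.+1 (e (s k + l)%N).
    by apply: (basis_in_nest on NP); rewrite sS ltn_add2l.
  apply: (total_ext tot) => b.
  have [kb|bk] := leqP (s k.+1) b.
    by rewrite !(nestAlg_coef0 NN_def NP _ (Nke i) kb).
  have SB (S B : nestAlg NN) (BM : forall k, 'M[R[i]]_(m k)) :
      (forall k (i : 'I_(m k)), B (e (s k + i)%N) = \sum_j BM k i j *: e (s k + j)%N) ->
      inner (ba_mul S B (e (s k + i)%N)) (e b) =
      \sum_j BM k i j * inner (S (e (s k + j)%N)) (e b).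
    move=> BE; rewrite [ba_mul S B _](_ : _ = S (B (e (s k + i)%N))) // BE.
    rewrite (bounded_operator_lin_comb _ _ _ _ (nest_op_bounded S)) inner_suml.
    by apply: eq_bigr => j _; rewrite innerZl.
  rewrite nestAlgDE innerDl (SB _ _ _ B1E) (SB _ _ _ B2E).
  have [h1 h2 _ _] := qP k.
  have SE (D0 : nestAlg NN) (DM : forall k, 'M[R[i]]_(m k)) j (l : 'I_(m k)) :
      (forall k (i : 'I_(m k)),
        D0 (e (s k + i)%N) = \sum_j DM k i j *: e (s k + j)%N) ->
      inner ((A 0 j + D0 : nestAlg NN) (e (s k + l)%N)) (e b) =
      inner (A 0 j (e (s k + l)%N)) (e b) + \sum_l' DM k l l' * (s k + l' == b)%N%:R.
    move=> DE; rewrite nestAlgDE innerDl DE inner_suml; congr (_ + _).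
    by apply: eq_bigr => l' _; rewrite innerZl on.
  under eq_bigr do rewrite (SE _ _ _ _ D1E).
  under [X in _ + X]eq_bigr do rewrite (SE _ _ _ _ D2E).
  have [bk'|kb] := ltnP b (s k).
    have off (DM : 'M[R[i]]_(m k)) l :
        \sum_l' DM l l' * (s k + l' == b)%N%:R = 0.
      rewrite big1 // => l' _; rewrite gtn_eqF ?mulr0 //.
      by rewrite (leq_trans bk') // leq_addr.
    under eq_bigr do rewrite off addr0.
    under [X in _ + X]eq_bigr do rewrite off addr0.
    move/matrixP: h2 => /(_ i (Ordinal bk')); rewrite !mxE on gtn_eqF; last first.
      by rewrite (leq_trans bk') // leq_addr.
    move=> h2; rewrite -[RHS]h2.
    by congr (_ + _); apply: eq_bigr => l _; rewrite mxE.
  have lm : (b - s k < m k)%N by rewrite ltn_subLR // -sS.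
  pose l0 := Ordinal lm; have bE : b = (s k + l0)%N by rewrite /= subnKC.
  have diag (DM : 'M[R[i]]_(m k)) l :
      \sum_l' DM l l' * (s k + l' == b)%N%:R = DM l l0.
    rewrite bE (bigD1 l0) //= eqxx mulr1 big1 ?addr0 // => l' ll'.
    by rewrite eqn_add2l (inj_eq val_inj l' l0) (negPf ll') mulr0.
  under eq_bigr do rewrite diag.
  under [X in _ + X]eq_bigr do rewrite diag.
  have -> : inner ((ba_one : nestAlg NN) (e (s k + i)%N)) (e b) =
      (1%:M : 'M[R[i]]_(m k)) i l0.
    by rewrite bE on eqn_add2l mxE (inj_eq val_inj).
  rewrite -h1 !mxE; congr (_ + _); apply: eq_bigr => l _; rewrite !mxE.
    by rewrite -bE.
  by rewrite -bE.
split=> // i j; rewrite (ord1 i) mxE -ball_normE /=.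
rewrite opprD addNKr normrN.
apply: (@le_lt_trans _ _ (2 * eps)); first by rewrite /D; case: ifP.
rewrite /eps mulrCA gtr_pMr // -[4]/((2 * 2)%:R) natrM invfM mulrA.
rewrite mulfV ?pnatr_eq0 // mul1r.
by rewrite invf_lt1 ?ltr0n // ltr1n.
Qed.
End Blocks.

(** * The stable ranks of the nest algebra *)

Lemma least_pos_infty (P : nat -> Prop) :
  (forall n, (0 < n)%N -> ~ P n) -> least_pos P = +oo%E.
Proof.
move=> nP; rewrite /least_pos; case: pselect => // exP; exfalso.
by case: exP => n /asboolP[/nP].
Qed.

Lemma least_pos2 (P : nat -> Prop) : ~ P 1%N -> P 2%N -> least_pos P = 2%N%:E.
Proof.
move=> nP1 P2; have P2' : `[< (0 < 2)%N /\ P 2%N >] by apply/asboolP.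
rewrite /least_pos; case: pselect => [ex|[]]; last by exists 2%N.
case: ex_minnP => k kP kmin; have [k0 Pk] := asboolW kP; have k2 := kmin _ P2'.
congr (_%:E); case: k k0 Pk k2 {kP kmin} => [|[|[|]]] //.
Qed.

Theorem theorem2p1 (R : realType) (H : hilbertType R) (NN : nest H)
    (N : nat -> set H) (n : nat -> nat)
    (NN_atomic : atomic_nest NN)
    (N_zero : N 0%N = [set 0])
    (N_lt : forall k, N k `<` N k.+1)
    (N_infty : closure (\bigcup_k N k) = setT)
    (NN_def : nest_set NN = range N `|` [set setT])
    (rank_atom : forall k, (1 <= k)%N ->
       has_rank (orth_proj (N k) \- orth_proj (N k.-1)) (n k))
    (rank_growth : forall k, (1 <= k)%N ->
       (4 * \sum_(1 <= i < k) n i <= n k)%N) :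
  ltsr (nestAlg NN) = +oo%E /\ rtsr (nestAlg NN) = 2%N%:E.
Proof.
have N_subspace k : subspace_set (N k).
  have NNk : nest_set NN (N k) by rewrite NN_def; left; exists k.
  by case: (nest_closed_subspace (nestP NN) NNk).
have [e [blk [on tot NP blkP]]] :=
  adapted_basis N_subspace N_zero N_lt N_infty rank_atom.
have s_unbounded a : exists k, (a < offset n k)%N.
  by exists (blk a).+1; case/andP: (blkP a).
have Lg_nd m := @Lg_not_dense _ _ NN N (offset n) e NN_def on tot NP m.
split; first exact: least_pos_infty.
apply: least_pos2.
  move=> dR; apply: (@Lg_nd 1%N) => // O O0 oO.
  have [A [OA RA]] := dR O O0 oO; exists A; split=> //.
  exact: (Rg1_sub_Lg1 NN_def on tot NP s_unbounded) RA.
apply: (@Rg2_dense _ _ NN N (offset n) (fun k => n k.+1) blk e) => //.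
- by rewrite /offset big_geq.
- exact: offsetS.
- move=> k; apply: leq_trans (rank_growth k.+1 isT).
  by rewrite leq_pmull.
Qed.
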